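(* Let $\xi$ be an irrational non-quadratic real number such that $\beta_0(\xi)<2$. Then there exists $\varepsilon_1>0$, depending only on $\beta_0(\xi)$, such that $\beta_\varepsilon(\xi)=\beta_0(\xi)$ for every $\varepsilon$ with $0<\varepsilon<\varepsilon_1$.
   Context: A real number $\xi$ is non-quadratic if $[\mathbb{Q}(\xi):\mathbb{Q}]\ge 3$. For $\underline{x}=(x_0,x_1,x_2)\in\mathbb{Z}^3$ put $L(\underline{x})=\max(|x_0\xi-x_1|,|x_0\xi^2-x_2|)$. For $0<\varepsilon\le 1$, $\beta_\varepsilon(\xi)$ is the infimum of the set of all $\beta$ such that for every sufficiently large $B>0$ there exists $\underline{x}\in\mathbb{Z}^3$ with $1\le|x_0|\le B$ and $L(\underline{x})\le\min(B^{-1/\beta},|x_0|^{\varepsilon-1})$ (and $+\infty$ if this set is empty); $\beta_0(\xi)=\sup_{0<\varepsilon<1}\beta_\varepsilon(\xi)$. *)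

(* Defs.v *)
From mathcomp Require Import all_boot all_order all_algebra.
From mathcomp Require Import all_classical all_reals all_analysis.

Set Implicit Arguments.
Unset Strict Implicit.
Unset Printing Implicit Defensive.

Import Order.TTheory GRing.Theory Num.Theory.
Import numFieldNormedType.Exports.

Local Open Scope classical_set_scope.
Local Open Scope ring_scope.

(* Q(xi): the smallest subfield of R containing xi. *)
Definition Q_adjoin (R : realType) (xi : R) : set R :=
  [set y | forall K : {pred R}, GRing.divring_closed K -> xi \in K -> y \in K].

(* [Q(xi) : Q] >= n; the degree may be infinite. *)
Definition degree_ge (R : realType) (n : nat) (xi : R) : Prop :=
  exists v : 'I_n -> R,
    (forall i, Q_adjoin xi (v i)) /\
    (forall c : 'I_n -> rat,
        \sum_(i < n) ratr (c i) * v i = 0 -> forall i, c i = 0).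

Definition non_quadratic (R : realType) (xi : R) : Prop := degree_ge 3 xi.

Definition Lxi (R : realType) (xi : R) (x0 x1 x2 : int) : R :=
  Num.max `|x0%:~R * xi - x1%:~R| `|x0%:~R * xi ^+ 2 - x2%:~R|.

(* Only b > 0 is meaningful: any b < 0 would satisfy the condition trivially
   (take x0 = 1), and 1 / b needs b != 0. *)
Definition beta_set (R : realType) (eps xi : R) : set R :=
  [set b : R | 0 < b /\
    \forall B \near +oo, exists x0 x1 x2 : int,
      [/\ 1 <= `|x0|, `|x0|%:~R <= B &
        Lxi xi x0 x1 x2 <=
          Num.min (B `^ (- (1 / b))) (`|x0|%:~R `^ (eps - 1))]].

(* ereal_inf set0 = +oo *)
Definition beta_eps (R : realType) (eps xi : R) : \bar R :=
  ereal_inf (EFin @` beta_set eps xi).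

Definition beta0 (R : realType) (xi : R) : \bar R :=
  ereal_sup [set beta_eps eps xi | eps in [set eps : R | 0 < eps < 1]].

(* Main.v *)
(* Measure a point x of Z^3 by sz x = ln x0 and lg x = - ln L(x), and call it
   eta-good when (1 - eta) sz x <= lg x. Since beta_0 < 2, for every eta > 0
   there are eta-good points p below any large size T with lg p >= w T, where
   w = 1/2 + e > 1/2. Three facts follow: good points have nonzero determinant
   x0 x2 - x1^2, hence lg x <= sz x + O(1); three points y, x, z of increasing
   size and precision with lg y >= w sz z are coplanar; and a rational plane
   through a good point y has height at least exp (e / 2 * sz y).

   Let x be eps-good with no eps'-good point both smaller and more precise.
   Take an eta-good y just before x and a 6 eta-good z just after it, and put
   d = sz z - lg y. The point x makes the height of the common plane at most
   about exp (d / 2), so this plane contains all eta-good points of precision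
   slightly above d / 2, in particular two such points a, b around d with
   lg a >= w sz b, so that sz b - sz a is smaller than d.
   Viewing points as symmetric matrices, y adj(a) b lies in the plane, is
   6 eta-good, smaller than z, and more precise than y by a fixed proportion
   of sz x. Iterating a bounded number of times contradicts lg <= sz + O(1).
   Hence every large eps-good point may be replaced by an eps'-good one. *)
Require Import Defs.
From mathcomp Require Import all_boot all_order all_algebra.
From mathcomp Require Import all_classical all_reals all_analysis.
From mathcomp Require Import ring lra zify.

Set Implicit Arguments.
Unset Strict Implicit.
Unset Printing Implicit Defensive.

Import Order.TTheory GRing.Theory Num.Theory.
Import numFieldNormedType.Exports.

Local Open Scope ring_scope.

(** * Integer points of [Z^3] and planes through the origin *)

Record pt := Pt { pt0 : int; pt1 : int; pt2 : int }.

(** The polar form of [qdet]: [bil u u = 2 * qdet u]. *)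
Definition bil (u v : pt) : int :=
  pt0 u * pt2 v + pt2 u * pt0 v - 2 * (pt1 u * pt1 v).
Definition qdet (u : pt) : int := pt0 u * pt2 u - pt1 u * pt1 u.
Definition dot (h p : pt) : int :=
  pt0 h * pt0 p + pt1 h * pt1 p + pt2 h * pt2 p.
Definition wedge (x y : pt) : pt :=
  Pt (pt1 x * pt2 y - pt2 x * pt1 y)
     (pt2 x * pt0 y - pt0 x * pt2 y)
     (pt0 x * pt1 y - pt1 x * pt0 y).
(* Twice the symmetric part of y adj(a) b, where (u0, u1, u2) stands for the
   symmetric matrix [[u0, u1], [u1, u2]]; y adj(a) b is itself symmetric when
   y, a, b are coplanar. *)
Definition bracket (y a b : pt) : pt :=
  Pt (bil y a * pt0 b + bil b a * pt0 y - bil y b * pt0 a)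
     (bil y a * pt1 b + bil b a * pt1 y - bil y b * pt1 a)
     (bil y a * pt2 b + bil b a * pt2 y - bil y b * pt2 a).
Definition oppt (p : pt) : pt := Pt (- pt0 p) (- pt1 p) (- pt2 p).
Definition pt_nz (h : pt) : Prop := ~ [/\ pt0 h = 0, pt1 h = 0 & pt2 h = 0].

Definition pos (p : pt) : Prop := 1 <= pt0 p.

Lemma pos_neq0 (p : pt) : pos p -> pt0 p != 0.
Proof. by rewrite /pos; lia. Qed.

Lemma dot_wedgel (x y : pt) : dot (wedge x y) x = 0.
Proof. rewrite /dot /wedge /=; ring. Qed.

Lemma dot_wedger (x y : pt) : dot (wedge x y) y = 0.
Proof. rewrite /dot /wedge /=; ring. Qed.

Lemma dot_wedgeC (x y z : pt) : dot (wedge x z) y = dot (wedge y x) z.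
Proof. rewrite /dot /wedge /=; ring. Qed.

(** Cramer's rule: each coordinate of [h] times the determinant of [u], [v], [w] is a combination of
    the three vanishing products. *)
Lemma dot_wedge_eq0 (h u v w : pt) : pt_nz h ->
  dot h u = 0 -> dot h v = 0 -> dot h w = 0 -> dot (wedge u v) w = 0.
Proof.
move=> hnz hu hv hw; apply/eqP/negPn/negP => D0; apply: hnz.
have E0 : pt0 h * dot (wedge u v) w =
    dot h u * pt0 (wedge v w) + dot h v * pt0 (wedge w u) + dot h w * pt0 (wedge u v).
  rewrite /dot /wedge /=; ring.
have E1 : pt1 h * dot (wedge u v) w =
    dot h u * pt1 (wedge v w) + dot h v * pt1 (wedge w u) + dot h w * pt1 (wedge u v).
  rewrite /dot /wedge /=; ring.
have E2 : pt2 h * dot (wedge u v) w =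
    dot h u * pt2 (wedge v w) + dot h v * pt2 (wedge w u) + dot h w * pt2 (wedge u v).
  rewrite /dot /wedge /=; ring.
split; apply: (mulIf D0); rewrite mul0r.
- by rewrite E0 hu hv hw !mul0r !addr0.
- by rewrite E1 hu hv hw !mul0r !addr0.
- by rewrite E2 hu hv hw !mul0r !addr0.
Qed.

Lemma dot_bracket (h y a b : pt) :
  dot h y = 0 -> dot h a = 0 -> dot h b = 0 -> dot h (bracket y a b) = 0.
Proof.
move=> hy ha hb.
have -> : dot h (bracket y a b) = bil y a * dot h b + bil b a * dot h y - bil y b * dot h a.
  rewrite /dot /bracket /=; ring.
by rewrite hy ha hb !mulr0 addr0 subrr.
Qed.

(** * Estimates in real coordinates *)

Section Approximation.
Variables (R : realType) (xi : R).

Definition e0 (p : pt) : R := (pt0 p)%:~R.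
Definition d1 (p : pt) : R := (pt0 p)%:~R * xi - (pt1 p)%:~R.
Definition d2 (p : pt) : R := (pt0 p)%:~R * xi ^+ 2 - (pt2 p)%:~R.
Definition Lp (p : pt) : R := Num.max `|d1 p| `|d2 p|.
(* In the coordinates (e0, d1, mf) the form qdet reads e0 * mf - d1 ^+ 2. *)
Definition mf (p : pt) : R := 2 * xi * d1 p - d2 p.
(** The constant of the passage between the coordinates [(d1, d2)] and [(d1, mf)], in both
    directions. *)
Definition Cm : R := 2 * `|xi| + 2.
(* h is a normal vector of a plane close to (1, xi, xi^2), so pt0 h is
   controlled by the other two coordinates. *)
Definition hnorm (h : pt) : R := `|(pt1 h)%:~R| + `|(pt2 h)%:~R|.
Definition sz (p : pt) : R := ln (e0 p).
Definition lg (p : pt) : R := - ln (Lp p).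

Lemma d1_le (p : pt) : `|d1 p| <= Lp p.
Proof. by rewrite /Lp le_max lexx. Qed.

Lemma d2_le (p : pt) : `|d2 p| <= Lp p.
Proof. by rewrite /Lp le_max lexx orbT. Qed.

Lemma Lp_ge0 (p : pt) : 0 <= Lp p.
Proof. exact: le_trans (normr_ge0 _) (d1_le p). Qed.

Lemma Cm_ge2 : 2 <= Cm.
Proof. rewrite /Cm; have := normr_ge0 xi; lra. Qed.

Lemma mf_le (p : pt) : `|mf p| <= Cm * Lp p.
Proof.
rewrite /mf /Cm; apply: le_trans (ler_normB _ _) _.
rewrite !normrM (ger0_norm (_ : 0 <= 2)) //.
have := d1_le p; have := d2_le p; have := normr_ge0 xi; have := Lp_ge0 p.
move: (normr_ge0 (d1 p)) => *; nra.
Qed.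

Lemma d2E (p : pt) : d2 p = 2 * xi * d1 p - mf p.
Proof. rewrite /mf; ring. Qed.

Lemma Lp_le (p : pt) (a b : R) : `|d1 p| <= a -> `|mf p| <= b -> Lp p <= Cm * a + b.
Proof.
move=> Ha Hb; have a0 := le_trans (normr_ge0 _) Ha; have b0 := le_trans (normr_ge0 _) Hb.
rewrite /Lp ge_max; apply/andP; split.
  have := Cm_ge2; nra.
rewrite d2E; apply: le_trans (ler_normB _ _) _.
rewrite !normrM (ger0_norm (_ : 0 <= 2)) // /Cm.
have := normr_ge0 xi; nra.
Qed.

Lemma qdetE (p : pt) : (qdet p)%:~R = e0 p * mf p - d1 p ^+ 2.
Proof. rewrite /qdet /e0 /mf /d1 /d2; ring. Qed.

Lemma dotE (h p : pt) : (dot h p)%:~R =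
  e0 p * ((pt0 h)%:~R + (pt1 h)%:~R * xi + (pt2 h)%:~R * xi ^+ 2)
  - ((pt1 h)%:~R * d1 p + (pt2 h)%:~R * d2 p).
Proof. rewrite /dot /e0 /d1 /d2; ring. Qed.

Lemma hdot_le (h p : pt) :
  `|(pt1 h)%:~R * d1 p + (pt2 h)%:~R * d2 p| <= hnorm h * Lp p.
Proof.
apply: le_trans (ler_normD _ _) _; rewrite !normrM /hnorm.
have := d1_le p; have := d2_le p.
have := normr_ge0 ((pt1 h)%:~R : R); have := normr_ge0 ((pt2 h)%:~R : R); nra.
Qed.

Lemma norm_int_ge1 (n : int) : n != 0 -> 1 <= `|n%:~R : R|.
Proof.
by move=> n0; rewrite -intr_norm (ler_int R 1); lia.
Qed.

Lemma e0_ge1 (p : pt) : pos p -> 1 <= e0 p.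
Proof. by rewrite /pos /e0 (ler_int R 1). Qed.

(** The nonzero integer [dot h p] is at least 1 in absolute value, while [w] in the plane bounds the
    linear form of [h] at [(1, xi, xi^2)] by [hnorm h * Lp w / e0 w]. *)
Lemma perp_bound (h p w : pt) : pos p -> pos w -> dot h p != 0 -> dot h w = 0 ->
  1 <= hnorm h * (e0 p * Lp w / e0 w + Lp p).
Proof.
move=> pp pw hp hw; apply: le_trans (norm_int_ge1 hp) _.
rewrite dotE; set th := (_ + _ * xi + _).
have p1 := e0_ge1 pp; have w1 := e0_ge1 pw.
have W0 : 0 < e0 w by lra.
have Hth : `|th| <= hnorm h * Lp w / e0 w.
  rewrite ler_pdivlMr // -[X in _ * X](gtr0_norm W0) -normrM.
  have := dotE h w; rewrite hw -/th => /esym/eqP; rewrite subr_eq add0r => /eqP E.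
  by rewrite mulrC E; exact: hdot_le.
apply: le_trans (ler_normB _ _) _; rewrite [leRHS]mulrDr.
apply: lerD; last exact: hdot_le.
rewrite normrM (ger0_norm (_ : 0 <= e0 p)); last by lra.
rewrite [leRHS](_ : _ = e0 p * (hnorm h * Lp w / e0 w)); last by ring.
by rewrite ler_wpM2l //; lra.
Qed.

Lemma cross_bound (x y : pt) : pos x -> pos y ->
  hnorm (wedge x y) <= 2 * (e0 x * Lp y + e0 y * Lp x).
Proof.
move=> px py; have x1 := e0_ge1 px; have y1 := e0_ge1 py.
have E1 : (pt1 (wedge x y))%:~R = e0 x * d2 y - e0 y * d2 x :> R.
  rewrite /wedge /e0 /d2 /=; ring.
have E2 : (pt2 (wedge x y))%:~R = e0 y * d1 x - e0 x * d1 y :> R.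
  rewrite /wedge /e0 /d1 /=; ring.
rewrite /hnorm E1 E2.
have A := ler_normB (e0 x * d2 y) (e0 y * d2 x).
have B := ler_normB (e0 y * d1 x) (e0 x * d1 y).
rewrite !normrM !(ger0_norm (_ : 0 <= e0 x)) ?(ger0_norm (_ : 0 <= e0 y)) in A B; try lra.
have := d1_le x; have := d2_le x; have := d1_le y; have := d2_le y; nra.
Qed.

Lemma det_bound (x y z : pt) : pos x -> pos y -> pos z -> dot (wedge x y) z != 0 ->
  1 <= 2 * (e0 x * Lp y * Lp z + e0 y * Lp x * Lp z + e0 z * Lp x * Lp y).
Proof.
move=> px py pz nz; apply: le_trans (norm_int_ge1 nz) _.
have x1 := e0_ge1 px; have y1 := e0_ge1 py; have z1 := e0_ge1 pz.
have -> : (dot (wedge x y) z)%:~R = e0 x * (d1 y * d2 z - d2 y * d1 z)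
  - e0 y * (d1 x * d2 z - d2 x * d1 z) + e0 z * (d1 x * d2 y - d2 x * d1 y).
  rewrite /dot /wedge /e0 /d1 /d2 /=; ring.
have H (u v : pt) : `|d1 u * d2 v - d2 u * d1 v| <= 2 * (Lp u * Lp v).
  apply: le_trans (ler_normB _ _) _; rewrite !normrM mulrDl !mul1r.
  by apply: lerD; apply: ler_pM; rewrite ?normr_ge0 ?d1_le ?d2_le.
have HH (c u v : R) : 1 <= c -> `|u| <= 2 * v -> `|c * u| <= 2 * (c * v).
  by move=> c1 Huv; rewrite normrM (ger0_norm (_ : 0 <= c)); nra.
apply: le_trans (ler_normD _ _) _; rewrite [leRHS]mulrDr -!mulrA; apply: lerD; last exact: HH.
apply: le_trans (ler_normB _ _) _; rewrite [leRHS]mulrDr; apply: lerD; exact: HH.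
Qed.

(** The vanishing determinant in the coordinates [(e0, d1, mf)], solved for [d1 p]: in the plane of
    [y] and [z], [d1 p] is controlled by [e0 p] and [mf p]. *)
Lemma det_mf (p y z : pt) : dot (wedge p y) z = 0 ->
  d1 p * (e0 z * mf y - e0 y * mf z) =
  - e0 p * (d1 y * mf z - d1 z * mf y) - mf p * (e0 y * d1 z - e0 z * d1 y).
Proof.
move=> H.
suff : (d1 p * (e0 z * mf y - e0 y * mf z)) -
  (- e0 p * (d1 y * mf z - d1 z * mf y) - mf p * (e0 y * d1 z - e0 z * d1 y)) =
   - (dot (wedge p y) z)%:~R by rewrite H oppr0 => /eqP; rewrite subr_eq0 => /eqP.
rewrite /dot /wedge /mf /e0 /d1 /d2 /=; ring.
Qed.

Lemma bracket_e0 (y a b : pt) : e0 (bracket y a b) =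
  2 * (e0 y * e0 b * mf a - d1 a * (d1 y * e0 b + d1 b * e0 y) + d1 y * d1 b * e0 a).
Proof. rewrite /bracket /bil /mf /e0 /d1 /d2 /=; ring. Qed.

Lemma bracket_mf (y a b : pt) : mf (bracket y a b) =
  2 * (e0 a * mf y * mf b - d1 y * d1 a * mf b - d1 b * d1 a * mf y + d1 y * d1 b * mf a).
Proof. rewrite /bracket /bil /mf /e0 /d1 /d2 /=; ring. Qed.

(** * The estimates in logarithmic form *)

Hypothesis xi_irr : forall n m : int, n != 0 -> n%:~R * xi != m%:~R.

(** An additive [K] absorbs the multiplicative constants of the estimates; [1 <= K] pays for the
    loss of 1 in [exp_sum_ge1]. *)
Definition log_const (K : R) : Prop := 1 <= K /\ 1000 * Cm ^+ 3 <= expR K.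

Lemma d1_neq0 (p : pt) : pos p -> d1 p != 0.
Proof. by rewrite /pos => pp; rewrite subr_eq0 xi_irr //; lia. Qed.

Lemma Lp_gt0 (p : pt) : pos p -> 0 < Lp p.
Proof. by move=> pp; apply: lt_le_trans (d1_le p); rewrite normr_gt0 d1_neq0. Qed.

Lemma e0_exp (p : pt) : pos p -> e0 p = expR (sz p).
Proof. by move=> pp; rewrite lnK // posrE; have := e0_ge1 pp; lra. Qed.

Lemma Lp_exp (p : pt) : pos p -> Lp p = expR (- lg p).
Proof. by move=> pp; rewrite opprK lnK // posrE Lp_gt0. Qed.

Lemma sz_ge0 (p : pt) : pos p -> 0 <= sz p.
Proof. by move=> pp; apply: ln_ge0; exact: e0_ge1. Qed.

(** Two terms below [expR (-1) <= 1 / 2] add up to less than 1. *)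
Lemma exp_sum_ge1 (a b : R) : 1 <= expR a + expR b -> 0 <= 1 + a \/ 0 <= 1 + b.
Proof.
move=> H; case: (leP 0 (1 + a)) => Ha; first by left.
right; case: (leP 0 (1 + b)) => // Hb.
have E : expR (-1) * expR 1 = 1 :> R by rewrite -expRD addNr expR0.
have H1 : 1 + 1 <= expR 1 :> R by exact: expR_ge1Dx.
have : expR a < expR (-1) by rewrite ltr_expR; lra.
have : expR b < expR (-1) by rewrite ltr_expR; lra.
have := expR_gt0 (-1 : R); nra.
Qed.

Lemma le_expK (K c a x : R) : log_const K -> 0 <= c -> c <= 1000 * Cm ^+ 3 ->
  x <= c * expR a -> x <= expR (K + a).
Proof.
move=> HK c0 cK; move/le_trans; apply.
by rewrite expRD ler_wpM2r ?expR_ge0 //; exact: le_trans cK HK.2.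
Qed.

Lemma Cm3_ge8 : 8 <= Cm ^+ 3.
Proof. by have := Cm_ge2 => H; rewrite !exprS expr0 mulr1; nra. Qed.

Lemma log_perp (K : R) (h p w : pt) : log_const K ->
  pos p -> pos w -> dot h p != 0 -> dot h w = 0 ->
  0 <= ln (hnorm h) + K + sz p - lg w - sz w \/ lg p <= ln (hnorm h) + K.
Proof.
move=> HK pp pw hp hw; have := perp_bound pp pw hp hw.
rewrite !e0_exp // !Lp_exp // -expRN -!expRD => H.
have H0 : 0 < hnorm h.
  rewrite lt_neqAle addr_ge0 ?normr_ge0 // andbT; apply/negP => /eqP E.
  by move: H; rewrite -E mul0r; lra.
move: H; rewrite -{1}(lnK H0) mulrDr -!expRD => /exp_sum_ge1 [H|H];
  [left|right]; have := HK.1; lra.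
Qed.

Lemma hnorm_nz (h : pt) : 0 < hnorm h -> pt_nz h.
Proof. by move=> H [_ a b]; move: H; rewrite /hnorm a b !normr0 addr0 ltxx. Qed.

Lemma lt_sz (x y : pt) : pos x -> pos y -> (sz x < sz y) = (pt0 x < pt0 y).
Proof.
by move=> px py; rewrite -ltr_expR -!e0_exp // ltr_int.
Qed.

(** For parallel points [Lp] is proportional to [e0], so the larger one would be strictly less
    precise. *)
Lemma wedge_gt0 (x y : pt) : pos x -> pos y -> sz x < sz y -> lg x <= lg y ->
  0 < hnorm (wedge x y).
Proof.
move=> px py sxy lxy; rewrite lt_neqAle addr_ge0 ?normr_ge0 // andbT; apply/negP => /eqP E.
have x1 := e0_ge1 px; have y1 := e0_ge1 py.
have E1 : (pt1 (wedge x y))%:~R = e0 x * d2 y - e0 y * d2 x :> R.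
  rewrite /wedge /e0 /d2 /=; ring.
have E2 : (pt2 (wedge x y))%:~R = e0 y * d1 x - e0 x * d1 y :> R.
  rewrite /wedge /e0 /d1 /=; ring.
move: E; rewrite /hnorm E1 E2 => E.
have n1 := normr_ge0 (e0 x * d2 y - e0 y * d2 x).
have n2 := normr_ge0 (e0 y * d1 x - e0 x * d1 y).
have /eqP Z1 : `|e0 x * d2 y - e0 y * d2 x| = 0 by lra.
have /eqP Z2 : `|e0 y * d1 x - e0 x * d1 y| = 0 by lra.
move: Z1 Z2; rewrite !normr_eq0 !subr_eq0 => /eqP Z1 /eqP Z2.
have Z : e0 y * Lp x = e0 x * Lp y.
  have gy : 0 <= e0 y by lra.
  have gx : 0 <= e0 x by lra.
  rewrite /Lp !maxr_pMr //.
  have ny t : e0 y * `|t| = `|e0 y * t| by rewrite normrM ger0_norm.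
  have nx t : e0 x * `|t| = `|e0 x * t| by rewrite normrM ger0_norm.
  by rewrite !ny !nx Z1 Z2.
have L1 : Lp y <= Lp x by rewrite !Lp_exp // ler_expR; lra.
have e1 : e0 x < e0 y by rewrite !e0_exp // ltr_expR.
have := Lp_gt0 px; have := Lp_gt0 py; nra.
Qed.

Lemma log_cross (K : R) (x y : pt) : log_const K ->
  pos x -> pos y -> sz x <= sz y -> lg x <= lg y ->
  0 < hnorm (wedge x y) -> ln (hnorm (wedge x y)) <= K + sz y - lg x.
Proof.
move=> HK px py sxy lxy H0; rewrite -ler_expR lnK // -addrA.
apply: (le_expK (c := 4) HK) => //; first by have := Cm3_ge8; lra.
apply: le_trans (cross_bound px py) _; rewrite !e0_exp // !Lp_exp // -!expRD.
have : expR (sz x - lg y) <= expR (sz y - lg x) by rewrite ler_expR; lra.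
lra.
Qed.

Lemma log_det (K : R) (x y z : pt) : log_const K -> pos x -> pos y -> pos z ->
  sz x <= sz y -> sz y <= sz z -> lg x <= lg y -> lg y <= lg z ->
  dot (wedge x y) z != 0 -> lg x + lg y <= sz z + K.
Proof.
move=> HK px py pz sxy syz lxy lyz nz.
suff : 1 <= expR (K + (sz z - lg x - lg y)).
  by rewrite -[X in X <= _]expR0 ler_expR; lra.
apply: (le_expK (c := 6) HK) => //; first by have := Cm3_ge8; lra.
apply: le_trans (det_bound px py pz nz) _; rewrite !e0_exp // !Lp_exp // -!expRD.
have : expR (sz x - lg y - lg z) <= expR (sz z - lg x - lg y) by rewrite ler_expR; lra.
have : expR (sz y - lg x - lg z) <= expR (sz z - lg x - lg y) by rewrite ler_expR; lra.
lra.
Qed.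

(** [e0 p * mf p - d1 p ^+ 2] is a nonzero integer of order at most [e0 p * Lp p], the square being
    harmless because [Lp p <= 1]. *)
Lemma log_qdet (K : R) (p : pt) : log_const K ->
  pos p -> 0 <= lg p -> qdet p != 0 -> lg p <= sz p + K.
Proof.
move=> HK pp l0 nz.
suff : 1 <= expR (K + (sz p - lg p)).
  by rewrite -[X in X <= _]expR0 ler_expR; lra.
apply: (le_expK (c := Cm + 1) HK).
- by have := Cm_ge2; lra.
- have := Cm_ge2 => H; rewrite !exprS expr0 mulr1; nra.
have p1 := e0_ge1 pp.
have L1 : Lp p <= 1 by rewrite Lp_exp // -[X in _ <= X]expR0 ler_expR; lra.
apply: le_trans (norm_int_ge1 nz) _; rewrite qdetE expRD -e0_exp // -Lp_exp //.
apply: le_trans (ler_normB _ _) _.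
rewrite !normrM (ger0_norm (_ : 0 <= e0 p)); last by lra.
have := mf_le p; have := d1_le p; have := normr_ge0 (d1 p); have := Lp_ge0 p.
move: `|d1 p| (Lp p) `|mf p| (e0 p) L1 p1 => D L M E *.
have : D * D <= E * L by nra.
have : E * M <= E * (Cm * L) by nra.
lra.
Qed.

Lemma Lp_small (p : pt) : pos p -> 4 <= lg p -> Lp p <= 1 / 16.
Proof.
move=> pp l4; rewrite Lp_exp // expRN ler_pdivlMr ?expR_gt0 //.
rewrite ler_pdivrMl ?expR_gt0 // mulr1.
apply: (@le_trans _ _ (expR 1 ^+ 4)); last by rewrite -expRM_natl ler_expR; lra.
have H1 : 1 + 1 <= expR 1 :> R by exact: expR_ge1Dx.
have : 4 <= expR 1 ^+ 2 :> R by rewrite expr2; nra.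
rewrite (exprM _ 2 2) [X in _ -> _ <= X]expr2; nra.
Qed.

(** The square [d1 p ^+ 2] is at most [1 / 256], so [e0 p * mf p] carries nearly all of the nonzero
    integer [qdet p]. *)
Lemma mf_lower (p : pt) : pos p -> 4 <= lg p -> qdet p != 0 -> 1 / 2 <= e0 p * `|mf p|.
Proof.
move=> pp l4 nz; have L1 := Lp_small pp l4; have p1 := e0_ge1 pp.
have := norm_int_ge1 nz; rewrite qdetE => H.
have := le_trans H (ler_normB _ _).
rewrite !normrM (ger0_norm (_ : 0 <= e0 p)); last by lra.
have := d1_le p; have := normr_ge0 (d1 p); nra.
Qed.

(** * Size and precision of the bracket of three points *)

Lemma bracket_e0_bounds (y a b : pt) : pos y -> pos a -> pos b ->
  4 <= lg y -> 4 <= lg a -> 4 <= lg b -> qdet a != 0 ->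
  sz a <= sz y -> sz a <= sz b ->
  0 < `|e0 (bracket y a b)| <= 8 * Cm * (e0 y * e0 b * Lp a).
Proof.
move=> py pa pb ly la lb qa; rewrite -(ler_expR (sz a) (sz y)) -(ler_expR (sz a) (sz b)).
rewrite -!e0_exp // bracket_e0.
have := mf_lower pa la qa; have := mf_le a.
have := Lp_small py ly; have := Lp_small pa la; have := Lp_small pb lb.
have := e0_ge1 py; have := e0_ge1 pa; have := e0_ge1 pb.
have := d1_le y; have := d1_le a; have := d1_le b.
have := Lp_ge0 y; have := Lp_ge0 a; have := Lp_ge0 b.
have := Cm_ge2.
move: (e0 y) (e0 a) (e0 b) (d1 y) (d1 a) (d1 b) (Lp y) (Lp a) (Lp b) (mf a) (Cm).
move=> Y A B y' a' b' Ly La Lb m C C2 Lb0 La0 Ly0 hb ha hy B1 A1 Y1 Lb1 La1 Ly1 mC mA AY AB.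
have N0 := normr_ge0.
set u := Y * B * m; set v := a' * _; set w := y' * b' * A.
have Eu : `|u| = Y * B * `|m|.
  by rewrite /u 2!normrM (ger0_norm (_ : 0 <= Y)) 1?(ger0_norm (_ : 0 <= B)); lra.
have Hv : `|v| <= La * (B + Y) / 16.
  rewrite /v normrM -mulrA ler_pM //.
  apply: le_trans (ler_normD _ _) _; rewrite !normrM.
  rewrite (ger0_norm (_ : 0 <= B)) 1?(ger0_norm (_ : 0 <= Y)); try lra.
  have : `|y'| * B <= 1 / 16 * B by rewrite ler_wpM2r; lra.
  have : `|b'| * Y <= 1 / 16 * Y by rewrite ler_wpM2r; lra.
  lra.
have Hw : `|w| <= A / 256.
  rewrite /w !normrM (ger0_norm (_ : 0 <= A)); last by lra.
  rewrite [leRHS]mulrC ler_wpM2r; try lra.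
  apply: (@le_trans _ _ (1/16 * (1/16))); last by lra.
  by apply: ler_pM => //; lra.
have AYB : A * A <= Y * B by rewrite ler_pM //; lra.
have ABY : A * B <= Y * B by rewrite ler_wpM2r //; lra.
have AYY : A * Y <= Y * B by rewrite mulrC ler_wpM2l //; lra.
have YB0 : 0 < Y * B by apply: mulr_gt0; lra.
apply/andP; split.
- rewrite normrM normr_nat; apply: mulr_gt0; first by lra.
  have T := lerB_normD u (- v + w).
  have T2 := ler_normD (- v) w; rewrite normrN in T2.
  rewrite -addrA; apply: lt_le_trans T; rewrite subr_gt0; apply: le_lt_trans T2 _.
  (* Scaled by [A], the leading term [u] is at least [Y * B / 2] by [mf_lower], whereas [v] and [w]
     together give at most [3 / 256] of [Y * B], because [A <= Y] and [A <= B]. *)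
  rewrite -(ltr_pM2l (_ : 0 < A)); last by lra.
  apply: (@lt_le_trans _ _ (Y * B / 2)).
    apply: (@le_lt_trans _ _ (A * ((B + Y) / 256 + A / 256))); last by nra.
    rewrite ler_wpM2l; try lra; apply: lerD => //; apply: le_trans Hv _; nra.
  rewrite Eu; nra.
- rewrite normrM normr_nat.
  have T := ler_normD (u - v) w; have T2 := ler_normB u v.
  have H1 : `|u| <= C * (Y * B * La) by rewrite Eu; nra.
  have H2 : `|v| <= Y * B * La.
    apply: le_trans Hv _; rewrite [leRHS]mulrC -mulrA ler_wpM2l //; nra.
  have H3 : A <= 2 * C * (Y * B * La).
    have h1 : A <= 2 * (A * A * `|m|) by nra.
    apply: le_trans h1 _.
    have : A * A * `|m| <= Y * B * (C * La) by apply: ler_pM => //; nra.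
    lra.
  have P0 : 0 <= Y * B * La by nra.
  have : Y * B * La <= C / 2 * (Y * B * La) by rewrite ler_peMl //; lra.
  nra.
Qed.

Lemma bracket_mf_bound (y a b : pt) : pos y -> pos a -> pos b ->
  4 <= lg y -> 4 <= lg a -> 4 <= lg b ->
  `|mf (bracket y a b)| <= 5 * Cm ^+ 2 * (e0 a * Lp y * Lp b).
Proof.
move=> py pa pb ly la lb; rewrite bracket_mf.
have := mf_le a; have := mf_le b; have := mf_le y.
have := Lp_small pa la; have := e0_ge1 pa.
have := d1_le y; have := d1_le a; have := d1_le b.
have := Lp_ge0 y; have := Lp_ge0 a; have := Lp_ge0 b.
have := Cm_ge2.
move: (e0 a) (d1 y) (d1 a) (d1 b) (Lp y) (Lp a) (Lp b) (mf y) (mf a) (mf b) (Cm).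
move=> A y' a' b' Ly La Lb my ma mb C C2 Lb0 La0 Ly0 hb ha hy A1 La1 Hy Hb Ha.
have N0 := normr_ge0.
have P0 : 0 <= Ly * Lb by apply: mulr_ge0.
have T1 : `|A * my * mb| <= C ^+ 2 * (A * Ly * Lb).
  rewrite !normrM (ger0_norm (_ : 0 <= A)); last by lra.
  rewrite -mulrA (_ : C ^+ 2 * _ = A * ((C * Ly) * (C * Lb))); last by ring.
  by rewrite ler_wpM2l //; [lra | apply: ler_pM].
have T2 : `|y' * a' * mb| <= C / 16 * (Ly * Lb).
  rewrite !normrM (_ : C / 16 * _ = Ly * (1/16) * (C * Lb)); last by field.
  apply: ler_pM; rewrite ?mulr_ge0 //; apply: ler_pM => //; lra.
have T3 : `|b' * a' * my| <= C / 16 * (Ly * Lb).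
  rewrite !normrM (_ : C / 16 * _ = Lb * (1/16) * (C * Ly)); last by field.
  apply: ler_pM; rewrite ?mulr_ge0 //; apply: ler_pM => //; lra.
have T4 : `|y' * b' * ma| <= C / 16 * (Ly * Lb).
  rewrite !normrM (_ : C / 16 * _ = Ly * Lb * (C * (1 / 16))); last by field.
  have Ha' : `|ma| <= C * (1 / 16) by apply: le_trans Ha _; rewrite ler_wpM2l //; lra.
  by apply: ler_pM; rewrite ?mulr_ge0 //; exact: ler_pM.
rewrite normrM normr_nat.
have U1 := ler_normD (A * my * mb - y' * a' * mb - b' * a' * my) (y' * b' * ma).
have U2 := ler_normB (A * my * mb - y' * a' * mb) (b' * a' * my).
have U3 := ler_normB (A * my * mb) (y' * a' * mb).
have V : Ly * Lb <= A * Ly * Lb by rewrite -mulrA ler_peMl.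
have CC : C <= C ^+ 2 by rewrite expr2; nra.
have W : C * (Ly * Lb) <= C ^+ 2 * (A * Ly * Lb) by apply: ler_pM => //; lra.
have : 0 <= C * (Ly * Lb) by apply: mulr_ge0; lra.
lra.
Qed.

(* Coplanarity is what makes d1 (bracket y a b) small: a direct estimate only
   gives e0 y * Lp a * Lp b. *)
Lemma bracket_Lp_bound (K : R) (y a b z : pt) : log_const K ->
  pos y -> pos a -> pos b -> pos z ->
  4 <= lg y -> 4 <= lg a -> 4 <= lg b -> qdet y != 0 ->
  2 * sz y - lg z + K <= sz z ->
  dot (wedge (bracket y a b) y) z = 0 ->
  Lp (bracket y a b) <= 50 * Cm ^+ 3 *
   (`|e0 (bracket y a b)| * e0 y * Lp y * Lp z / e0 z + e0 y * Lp y * (e0 a * Lp y * Lp b)).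
Proof.
move=> HK py pa pb pz ly la lb qy Hyz D.
have Hm := bracket_mf_bound py pa pb ly la lb.
have H1 := mf_lower py ly qy.
have Hz : 4 * Cm * (e0 y * Lp z) * e0 y <= e0 z.
  rewrite e0_exp // Lp_exp // (e0_exp pz).
  apply: (@le_trans _ _ (expR (K + (2 * sz y - lg z)))); last by rewrite ler_expR; lra.
  apply: (le_expK (c := 4 * Cm) HK).
  - by have := Cm_ge2; lra.
  - have := Cm_ge2 => H; rewrite !exprS expr0 mulr1; nra.
  rewrite -mulrA ler_wpM2l //; first by have := Cm_ge2; lra.
  by rewrite -!expRD ler_expR; lra.
have := det_mf D; have := mf_le y; have := mf_le z.
have := e0_ge1 py; have := e0_ge1 pa; have := e0_ge1 pz.
have := d1_le y; have := d1_le z.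
have := Lp_ge0 y; have := Lp_ge0 z; have := Lp_ge0 b.
have := Cm_ge2; have N0 := normr_ge0.
have HL := @Lp_le (bracket y a b).
move: HL Hm; move: (bracket y a b) D => p _.
move=> HL Hm C2 Lb0 Lz0 Ly0 hz hy Z1 A1 Y1 mz my E.
have Y0 : 0 < e0 y by lra.
have Z0 : 0 < e0 z by lra.
(* This is the coefficient of [d1 p] in [det_mf]: [mf_lower] keeps [e0 z * mf y] large, and [Hz]
   makes the other term at most half of that lower bound. *)
have low : e0 z / (4 * e0 y) <= `|e0 z * mf y - e0 y * mf z|.
  apply: le_trans (lerB_dist _ _).
  rewrite !normrM (ger0_norm (_ : 0 <= e0 z)) 1?(ger0_norm (_ : 0 <= e0 y)); try lra.
  rewrite ler_pdivrMr; last by lra.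
  have h1 : e0 z / 2 <= e0 z * (e0 y * `|mf y|) by nra.
  have h2 : e0 y * `|mf z| * e0 y <= Cm * (e0 y * Lp z) * e0 y.
    rewrite ler_wpM2r; try lra; rewrite mulrCA ler_wpM2l //; lra.
  lra.
have up : `|e0 z * mf y - e0 y * mf z| * `|d1 p| <=
   2 * Cm * (`|e0 p| * Lp y * Lp z) + `|mf p| * (e0 y * Lp z + e0 z * Lp y).
  rewrite -normrM mulrC E; apply: le_trans (ler_normB _ _) _.
  rewrite !normrM normrN; apply: lerD.
    rewrite (_ : 2 * Cm * _ =
      `|e0 p| * (Lp y * (Cm * Lp z) + Lp z * (Cm * Lp y))); last by ring.
    rewrite ler_wpM2l //; apply: le_trans (ler_normB _ _) _; rewrite !normrM.
    by apply: lerD; apply: ler_pM.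
  rewrite ler_wpM2l //; apply: le_trans (ler_normB _ _) _; rewrite !normrM.
  rewrite (ger0_norm (_ : 0 <= e0 z)) 1?(ger0_norm (_ : 0 <= e0 y)); try lra.
  by apply: lerD; rewrite ler_wpM2l //; lra.
have Yl : 1 <= 2 * Cm * (e0 y * Lp y).
  have : e0 y * `|mf y| <= e0 y * (Cm * Lp y) by rewrite ler_wpM2l //; lra.
  lra.
have YLz : e0 y * Lp z <= e0 z * Lp y.
  rewrite -(ler_pM2l (_ : 0 < 4 * Cm * e0 y)); last by apply: mulr_gt0; lra.
  have : e0 z * 1 <= e0 z * (2 * Cm * (e0 y * Lp y)) by rewrite ler_wpM2l //; lra.
  move: Hz; nra.
have d1p : `|d1 p| <= 8 * Cm * (`|e0 p| * e0 y * Lp y * Lp z / e0 z)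
    + 8 * (e0 y * Lp y) * `|mf p|.
  have low' : e0 z / (4 * e0 y) * `|d1 p| <=
      2 * Cm * (`|e0 p| * Lp y * Lp z) + `|mf p| * (2 * (e0 z * Lp y)).
    apply: le_trans (_ : _ <= `|e0 z * mf y - e0 y * mf z| * `|d1 p|) _.
      by rewrite ler_wpM2r.
    apply: le_trans up _; apply: lerD => //; rewrite ler_wpM2l //; lra.
  rewrite -(ler_pM2l (_ : 0 < e0 z / (4 * e0 y))); last by apply: divr_gt0; lra.
  apply: le_trans low' _; rewrite le_eqVlt; apply/orP; left; apply/eqP.
  by field; apply/andP; split; lra.
have := HL _ _ d1p (lexx _); move/le_trans; apply.
have mp0 := normr_ge0 (mf p).
set t1 := `|e0 p| * _ * _ * _ / _; set t2 := e0 y * Lp y * _.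
have t10 : 0 <= t1.
  by rewrite /t1 !mulr_ge0 ?invr_ge0 //; lra.
have YM : e0 y * Lp y * `|mf p| <= 5 * Cm ^+ 2 * t2.
  rewrite /t2 mulrCA ler_wpM2l // mulr_ge0 //; lra.
have M1 : `|mf p| <= 2 * Cm * (e0 y * Lp y * `|mf p|).
  rewrite mulrA -[leLHS]mul1r ler_wpM2r //; lra.
have S : 10 * Cm * (e0 y * Lp y * `|mf p|) <= 10 * Cm * (5 * Cm ^+ 2 * t2).
  by rewrite ler_wpM2l //; lra.
have C23 : 8 * Cm ^+ 2 * t1 <= 50 * Cm ^+ 3 * t1.
  rewrite ler_wpM2r // !exprS expr0 mulr1; nra.
rewrite mulrDr [in leRHS](mulrDr (50 * Cm ^+ 3)).
move: S C23 M1; rewrite !exprS !expr0 !mulr1; lra.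
Qed.

(** From [1 + t <= expR t] at [t = - 1 / 4], raised to the fourth power. *)
Lemma expR1_le4 : expR 1 <= 4 :> R.
Proof.
have a2 : expR (-1) = expR (- (1/4)) ^+ 4 :> R.
  by rewrite -expRM_natl; congr expR; lra.
have a3 : 3/4 <= expR (- (1/4)) :> R.
  by have := expR_ge1Dx (- (1/4) : R); lra.
have a4 : 9/16 <= expR (- (1/4)) ^+ 2 :> R by rewrite expr2; nra.
have a5 : 9/16 * (9/16) <= expR (-1) :> R.
  by rewrite a2 (exprM _ 2 2) [leRHS]expr2; apply: ler_pM => //; lra.
have E : expR (-1) * expR 1 = 1 :> R by rewrite -expRD addNr expR0.
rewrite -(ler_pM2l (expR_gt0 (-1))) E; lra.
Qed.

(** [p] is the bracket up to sign; the two alternatives tell which term of [bracket_Lp_bound]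
    dominates. *)
Lemma log_bracket (K : R) (y a b z : pt) : log_const K -> pos y -> pos a -> pos b -> pos z ->
  4 <= lg y -> 4 <= lg a -> 4 <= lg b -> qdet a != 0 -> qdet y != 0 ->
  sz a <= sz y -> sz a <= sz b -> 2 * sz y - lg z + K <= sz z ->
  dot (wedge (bracket y a b) y) z = 0 ->
  exists p : pt, [/\ pos p, sz p <= sz y + sz b - lg a + K &
    sz z + lg y + lg z - sz y - sz p - K <= lg p \/
    2 * lg y + lg b - sz a - sz y - K <= lg p].
Proof.
move=> HK py pa pb pz ly la lb qa qy ay ab Hyz D.
have /andP[g0 gU] := bracket_e0_bounds py pa pb ly la lb qa ay ab.
have HL := bracket_Lp_bound HK py pa pb pz ly la lb qy Hyz D.
set w := bracket y a b in g0 gU HL *; clearbody w.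
have [p [pp Ep EL]] : exists p, [/\ pos p, e0 p = `|e0 w| & Lp p = Lp w].
  have w0 : pt0 w != 0.
    by apply/negP => /eqP E; move: g0; rewrite /e0 E normr0 ltxx.
  case: (leP 0 (pt0 w)) => Hw.
    exists w; split => //; first by rewrite /pos; lia.
    by rewrite /e0 ger0_norm // ler0z.
  exists (oppt w); split; first by rewrite /pos /=; lia.
    by rewrite /e0 ltr0_norm ?ltrz0 //= rmorphN.
  rewrite /Lp; congr Num.max; rewrite -normrN; congr `|_|; rewrite /d1 /d2 /=; ring.
exists p; split => //.
  rewrite -ler_expR -e0_exp // Ep.
  rewrite (_ : _ + K = K + (sz y + sz b - lg a)); last by ring.
  apply: (le_expK (c := 8 * Cm) HK).
  - by have := Cm_ge2; lra.
  - have := Cm_ge2 => H; rewrite !exprS expr0 mulr1; nra.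
  by rewrite !expRD -Lp_exp // -!e0_exp.
have := Cm3_ge8 => C8.
move: HL; rewrite -EL -Ep (Lp_exp pp) !e0_exp // !Lp_exp // -expRN -!expRD.
set u := _ - sz z; set v := _ + (sz a + _ + _) => HL.
(* One unit is taken from [K] beforehand, since [exp_sum_ge1] adds one back. *)
have : 1 <= expR (K - 1 + u + lg p) + expR (K - 1 + v + lg p).
  have e1 := expR1_le4.
  have E : expR K = expR (K - 1) * expR 1 by rewrite -expRD subrK.
  have k1 : 50 * Cm ^+ 3 <= expR (K - 1).
    have := expR_gt0 (K - 1); have := HK.2; rewrite E; nra.
  have p0 := expR_gt0 (lg p); have u0 := expR_gt0 u; have v0 := expR_gt0 v.
  have H2 : 1 <= 50 * Cm ^+ 3 * (expR u + expR v) * expR (lg p).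
    have : expR (- lg p) * expR (lg p) <= 50 * Cm ^+ 3 * (expR u + expR v) * expR (lg p).
      by rewrite ler_wpM2r // ltW.
    by rewrite -expRD addNr expR0.
  apply: le_trans H2 _; rewrite !(expRD (K - 1 + _)) !(expRD (K - 1)) -!mulrDl -mulrDr.
  by rewrite !ler_wpM2r ?addr_ge0 ?expR_ge0.
case/exp_sum_ge1; rewrite /u /v => H; [left|right]; have := HK.1; lra.
Qed.

(** * Minimal points and lower bounds for [Lp] *)

(** Size increases with the positive integer [pt0], so minima exist by well-ordering. *)
Lemma min_sz (Phi : pt -> Prop) : (exists p, pos p /\ Phi p) ->
  exists p, [/\ pos p, Phi p & forall p', pos p' -> sz p' < sz p -> ~ Phi p'].
Proof.
case=> q [pq Pq].
pose P (n : nat) := `[< exists p, [/\ pos p, Phi p & pt0 p = n%:Z] >].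
have exP : exists n, P n.
  exists `|pt0 q|%N; apply/asboolP; exists q; split => //.
  by move: pq; rewrite /pos; lia.
case: (ex_minnP exP) => n /asboolP [p [pp Pp En]] nmin.
exists p; split => // p' pp'; rewrite lt_sz // En => lt' Pp'.
have : P `|pt0 p'|%N.
  by apply/asboolP; exists p'; split => //; move: pp'; rewrite /pos; lia.
by move/nmin; move: pp' lt'; rewrite /pos; lia.
Qed.

Lemma dist_int_gt0 (n : int) : n != 0 ->
  exists2 c : R, 0 < c & forall m : int, c <= `|n%:~R * xi - m%:~R|.
Proof.
move=> n0; set t := n%:~R * xi.
have f1 := Num.Theory.floor_le_tmp t; have f2 := Num.Theory.floorD1_gt t.
set f := Num.floor t in f1 f2.
have t1 : f%:~R < t by rewrite lt_neqAle f1 andbT eq_sym /t xi_irr.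
exists (Num.min (t - f%:~R) ((f + 1)%:~R - t)).
  by rewrite lt_min; apply/andP; split; rewrite subr_gt0.
move=> m; case: (leP m f) => mf'.
  have : m%:~R <= f%:~R :> R by rewrite ler_int.
  by rewrite ge_min => H; apply/orP; left; rewrite ger0_norm; lra.
have : (f + 1)%:~R <= m%:~R :> R by rewrite ler_int; lia.
by rewrite ge_min => H; apply/orP; right; rewrite ler0_norm; lra.
Qed.

Lemma Lp_lower (N : nat) :
  exists2 c : R, 0 < c & forall p, pos p -> pt0 p <= N%:Z -> c <= Lp p.
Proof.
elim: N => [|N [c c0 IH]].
  by exists 1 => // p; rewrite /pos; lia.
have [//|c' c'0 H'] := @dist_int_gt0 (N.+1)%:Z.
exists (Num.min c c') => [|p pp pN]; first by rewrite lt_min c0.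
rewrite ge_min; apply/orP; case: (leP (pt0 p) N%:Z) => H; [left|right].
  exact: IH.
apply: le_trans (d1_le p); rewrite /d1 (_ : pt0 p = (N.+1)%:Z) //; lia.
Qed.

(** Finitely many [pt0] occur up to a given size, and for each irrationality keeps [Lp] away from 0.
    Thus great precision forces great size. *)
Lemma lg_bounded (S : R) : exists M : R, forall p, pos p -> sz p <= S -> lg p <= M.
Proof.
have [c c0 H] := Lp_lower (Num.truncn (expR S)).
exists (- ln c) => p pp pS; rewrite lerN2 ler_ln ?posrE ?Lp_gt0 //.
apply: H => //; have := pS; rewrite -ler_expR -e0_exp // => h.
have e1 := e0_ge1 pp.
have h2 := truncnS_gt (expR S).
have : e0 p < (Num.truncn (expR S)).+1%:~R by apply: le_lt_trans h h2.
rewrite ltr_int; lia.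
Qed.

(** * Good points and points of zero determinant *)

Definition good (eta : R) (p : pt) : Prop := pos p /\ (1 - eta) * sz p <= lg p.

Lemma good_le (eta eta' : R) (p : pt) : eta <= eta' -> good eta p -> good eta' p.
Proof.
move=> le [pp H]; split => //; apply: le_trans H; rewrite ler_wpM2r ?sz_ge0 //; lra.
Qed.

(* The divisor gcd(p0, p1) of both 2x2 minors is at least the square root of
   p0, because p0 divides p0^2, p0 p1 and p1^2 = p0 p2. *)
Lemma qdet0_bound (p z : pt) : pos p -> pos z -> qdet p = 0 -> Lp p <= 1 ->
  0 < hnorm (wedge p z) ->
  e0 p <= (Cm * (e0 p * Lp z + e0 z * Lp p)) ^+ 2.
Proof.
move=> pp pz q0 L1 wnz.
pose g := gcdn `|pt0 p|%N `|pt1 p|%N.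
have p0 : (0 < `|pt0 p|)%N by move: pp; rewrite /pos; lia.
have qE : (`|pt1 p| * `|pt1 p| = `|pt0 p| * `|pt2 p|)%N.
  by rewrite -!abszM; congr absz; move: q0; rewrite /qdet; lia.
have dv : (`|pt0 p| %| g * g)%N.
  rewrite /g muln_gcdl dvdn_gcd dvdn_mulr //= mulnC muln_gcdl dvdn_gcd dvdn_mulr //=.
  by rewrite qE dvdn_mulr.
have g0 : (0 < g)%N by rewrite gcdn_gt0 p0.
have lg2 : (`|pt0 p| <= g * g)%N by apply: dvdn_leq => //; rewrite muln_gt0 g0.
have P1' : 1 <= e0 p := e0_ge1 pp.
have Z1 : 1 <= e0 z := e0_ge1 pz.
have E : e0 p = (`|pt0 p|%N)%:R.
  by rewrite /e0 -[in LHS](gez0_abs (_ : 0 <= pt0 p)) //; move: pp; rewrite /pos; lia.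
have n0 := normr_ge0.
have bnd (n : int) : n != 0 -> (g%:Z %| n)%Z ->
    `|n%:~R| <= Cm * (e0 p * Lp z + e0 z * Lp p) ->
    e0 p <= (Cm * (e0 p * Lp z + e0 z * Lp p)) ^+ 2.
  move=> nz dn bn.
  have gn : g%:R <= `|n%:~R| :> R.
    rewrite -intr_norm -abszE ler_nat; apply: dvdn_leq; first by lia.
    by move: dn; rewrite dvdzE.
  have h := le_trans gn bn.
  apply: (@le_trans _ _ (g%:R * g%:R)); first by rewrite E -natrM ler_nat.
  by rewrite expr2 ler_pM.
have dg0 : (g%:Z %| pt0 p)%Z by rewrite dvdzE dvdn_gcdl.
have dg1 : (g%:Z %| pt1 p)%Z by rewrite dvdzE dvdn_gcdr.
case: (eqVneq (pt0 p * pt1 z - pt1 p * pt0 z) 0) => Ha; last first.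
  apply: (bnd _ Ha); first by rewrite rpredB // dvdz_mulr.
  have -> : (pt0 p * pt1 z - pt1 p * pt0 z)%:~R = e0 z * d1 p - e0 p * d1 z.
    rewrite /e0 /d1; ring.
  apply: le_trans (ler_normB _ _) _.
  rewrite !normrM (ger0_norm (_ : 0 <= e0 z)) 1?(ger0_norm (_ : 0 <= e0 p)); try lra.
  have h1 : e0 z * `|d1 p| <= e0 z * Lp p by rewrite ler_wpM2l ?d1_le //; lra.
  have h2 : e0 p * `|d1 z| <= e0 p * Lp z by rewrite ler_wpM2l ?d1_le //; lra.
  have h3 : 0 <= e0 z * Lp p by rewrite mulr_ge0 ?Lp_ge0 //; lra.
  have h4 : 0 <= e0 p * Lp z by rewrite mulr_ge0 ?Lp_ge0 //; lra.
  have := Cm_ge2; nra.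
(* [pt1 (wedge p z)] need not be divisible by [g]; this combination is, and as [qdet p = 0], its
   vanishing together with the previous one forces [pt1 (wedge p z) = 0]. *)
case: (eqVneq (pt0 p * pt2 z - pt1 p * pt1 z) 0) => Hb; last first.
  apply: (bnd _ Hb); first by rewrite rpredB // dvdz_mulr.
  have -> : (pt0 p * pt2 z - pt1 p * pt1 z)%:~R =
     e0 p * (xi * d1 z - d2 z) + d1 p * (xi * e0 z - d1 z).
    rewrite /e0 /d1 /d2; ring.
  apply: le_trans (ler_normD _ _) _.
  rewrite !normrM (ger0_norm (_ : 0 <= e0 p)); try lra.
  have h1 := d1_le z; have h2 := d2_le z; have h3 := d1_le p.
  have a1 : `|xi * d1 z - d2 z| <= (`|xi| + 1) * Lp z.
    apply: le_trans (ler_normB _ _) _; rewrite normrM mulrDl mul1r.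
    by apply: lerD => //; rewrite ler_wpM2l.
  have a2 : `|xi * e0 z - d1 z| <= `|xi| * e0 z + Lp z.
    apply: le_trans (ler_normB _ _) _; rewrite normrM (ger0_norm (_ : 0 <= e0 z)); try lra.
  have a3 : `|d1 p| * `|xi * e0 z - d1 z| <= Lp p * (`|xi| * e0 z + Lp z) by apply: ler_pM.
  have a4 : e0 p * `|xi * d1 z - d2 z| <= e0 p * ((`|xi| + 1) * Lp z).
    by rewrite ler_wpM2l //; lra.
  have a5 : Lp p * Lp z <= e0 p * Lp z.
    by rewrite ler_wpM2r ?Lp_ge0 //; lra.
  have b1 : 0 <= e0 z * Lp p by rewrite mulr_ge0 ?Lp_ge0 //; lra.
  have b2 : 0 <= e0 p * Lp z by rewrite mulr_ge0 ?Lp_ge0 //; lra.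
  have b3 : 0 <= `|xi| * (e0 z * Lp p) by rewrite mulr_ge0.
  have b4 : 0 <= `|xi| * (e0 p * Lp z) by rewrite mulr_ge0.
  rewrite /Cm; lra.
exfalso; move: wnz.
have p0' : pt0 p != 0 by move: pp; rewrite /pos; lia.
suff -> : hnorm (wedge p z) = 0 by rewrite ltxx.
have h2 : pt2 (wedge p z) = 0 by [].
have h1 : pt1 (wedge p z) = 0.
  have : pt0 p * pt1 (wedge p z) = 0.
    have -> : pt0 p * pt1 (wedge p z) = qdet p * pt0 z
       - pt1 p * (pt0 p * pt1 z - pt1 p * pt0 z)
       - pt0 p * (pt0 p * pt2 z - pt1 p * pt1 z).
      rewrite /wedge /qdet /=; ring.
    by rewrite q0 Ha Hb; ring.
  by move/eqP; rewrite mulf_eq0 (negbTE p0') => /eqP.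
by rewrite /hnorm h1 h2 !normr0 addr0.
Qed.

(* The exponent 1/b of the definition of beta_set is w here. *)
Definition uniform (w : R) : Prop := forall eta : R, 0 < eta < 1 ->
  exists T0 : R, forall T, T0 <= T ->
  exists p, [/\ good eta p, sz p < T & w * T - 1 <= lg p].

Lemma log_const_ex (M : R) : exists2 K : R, log_const K & M <= K.
Proof.
exists (Num.max (1 + 1000 * Cm ^+ 3) M); last by rewrite le_max lexx orbT.
have c3 := Cm3_ge8.
split; first by rewrite le_max; apply/orP; left; lra.
have : 1 + 1000 * Cm ^+ 3 <= Num.max (1 + 1000 * Cm ^+ 3) M by rewrite le_max lexx.
set m := Num.max _ _; have := expR_ge1Dx m; lra.
Qed.

(** * Consequences of uniform approximation with exponent above 1/2 *)

Section Uniform.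
Hypothesis xi_indep : forall h : pt, pt_nz h ->
  (pt0 h)%:~R + (pt1 h)%:~R * xi + (pt2 h)%:~R * xi ^+ 2 != 0.
Variable e : R.
Hypothesis e_gt0 : 0 < e.
Hypothesis e_le : e <= 1 / 6.
Hypothesis unif : uniform (1 / 2 + e).

(** Were [qdet p = 0], let [p'] be the smallest point on the line of [p] and [z] a good point just
    below it. They are not parallel, and [qdet0_bound] bounds [2 * e * sz p'] by a constant. *)
Lemma qdet_neq0_large : exists S : R, forall p, good (1 / 4) p -> S <= sz p -> qdet p != 0.
Proof.
have e0' := e_gt0; have e1 := e_le.
have [T0 HT] : exists T0 : R, forall T, T0 <= T ->
  exists p, [/\ good (1 / 4) p, sz p < T & (1 / 2 + e) * T - 1 <= lg p].
  by apply: unif; apply/andP; split; lra.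
have C2 := Cm_ge2.
pose c := ln (4 * Cm ^+ 2).
(* Beyond the last bound [2 * e * s > c + 3], whereas the final estimate gives
   [2 * e * s <= c + 2]. *)
pose S1 := Num.max T0 (Num.max 0 ((c + 3) / (2 * e))).
have [M HM] := lg_bounded S1.
exists (S1 + M + 1) => p [pp gp] Sp; apply/negP => /eqP q0.
pose par (x : pt) := pt0 p * pt1 x = pt1 p * pt0 x /\ pt0 p * pt2 x = pt2 p * pt0 x.
have [|p' [pp' [par1 par2] pmin]] := @min_sz par.
  by exists p; split => //; split; ring.
have le' : sz p' <= sz p.
  by rewrite leNgt; apply/negP => /(pmin _ pp); apply; split; ring.
have p0 := pos_neq0 pp.
have P1' := e0_ge1 pp; have P1'' := e0_ge1 pp'.
have par1R : e0 p * d1 p' = e0 p' * d1 p.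
  have : e0 p * (pt1 p')%:~R = (pt1 p)%:~R * e0 p' by rewrite -!intrM par1.
  rewrite /d1 /e0 => H; lra.
have par2R : e0 p * d2 p' = e0 p' * d2 p.
  have : e0 p * (pt2 p')%:~R = (pt2 p)%:~R * e0 p' by rewrite -!intrM par2.
  rewrite /d2 /e0 => H; lra.
have LL : e0 p * Lp p' = e0 p' * Lp p.
  have g1 : 0 <= e0 p by lra.
  have g2 : 0 <= e0 p' by lra.
  rewrite /Lp !maxr_pMr //.
  have n1 t : e0 p * `|t| = `|e0 p * t| by rewrite normrM ger0_norm.
  have n2 t : e0 p' * `|t| = `|e0 p' * t| by rewrite normrM ger0_norm.
  by rewrite !n1 !n2 par1R par2R.
have ll : sz p - lg p' = sz p' - lg p.
  apply: expR_inj; rewrite !expRD -!e0_exp // -!Lp_exp //.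
have q0' : qdet p' = 0.
  have : pt0 p * pt0 p * qdet p' = 0.
    have -> : pt0 p * pt0 p * qdet p' = pt0 p * pt0 p' * (pt0 p * pt2 p') -
       (pt0 p * pt1 p') * (pt0 p * pt1 p') by rewrite /qdet; ring.
    rewrite par1 par2.
    have -> : pt0 p * pt0 p' * (pt2 p * pt0 p') - pt1 p * pt0 p' * (pt1 p * pt0 p') =
       qdet p * (pt0 p' * pt0 p') by rewrite /qdet; ring.
    by rewrite q0 mul0r.
  by move/eqP; rewrite !mulf_eq0 (negbTE p0) => /eqP.
have s0 := sz_ge0 pp; have s0' := sz_ge0 pp'.
(* Since [lg p' = lg p + sz p - sz p'], a small [p'] would have precision above [M]. *)
have big : S1 < sz p'.
  rewrite ltNge; apply/negP => h; have h2 := HM _ pp' h; lra.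
have [T0s' [z0s cs]] : T0 <= sz p' /\ 0 <= sz p' /\ (c + 3) / (2 * e) < sz p'.
  by move: big; rewrite /S1 !gt_max => /andP[a /andP[b d]]; split; lra.
have [z [[pz gz] zs lz]] := HT _ T0s'.
have npar : 0 < hnorm (wedge p' z).
  rewrite lt_neqAle addr_ge0 ?normr_ge0 // andbT; apply/negP => /eqP E.
  have n1 := normr_ge0 ((pt1 (wedge p' z))%:~R : R).
  have n2 := normr_ge0 ((pt2 (wedge p' z))%:~R : R).
  have /eqP Z1 : `|(pt1 (wedge p' z))%:~R : R| = 0 by move: E; rewrite /hnorm; lra.
  have /eqP Z2 : `|(pt2 (wedge p' z))%:~R : R| = 0 by move: E; rewrite /hnorm; lra.
  move: Z1 Z2; rewrite !normr_eq0 !intr_eq0 /= => /eqP Z1 /eqP Z2.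
  have p0' := pos_neq0 pp'.
  apply: (pmin _ pz zs); split; apply: (mulfI p0').
    have -> : pt0 p' * (pt0 p * pt1 z) = pt0 p * (pt0 p' * pt1 z - pt1 p' * pt0 z)
       + (pt0 p * pt1 p') * pt0 z by ring.
    by rewrite Z2 par1; ring.
  have -> : pt0 p' * (pt0 p * pt2 z) = - pt0 p * (pt2 p' * pt0 z - pt0 p' * pt2 z)
     + (pt0 p * pt2 p') * pt0 z by ring.
  by rewrite Z1 par2; ring.
have lp' : 3 / 4 * sz p' <= lg p' by lra.
have L1 : Lp p' <= 1.
  by rewrite Lp_exp // -[leRHS]expR0 ler_expR; lra.
have := qdet0_bound pp' pz q0' L1 npar.
rewrite !e0_exp // !Lp_exp // -!expRD => H.
set s := sz p' in H lz zs lp' s0' cs *.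
have H1 : expR (s - lg z) <= expR (s / 2 - e * s + 1) by rewrite ler_expR; lra.
have H2 : expR (sz z - lg p') <= expR (s / 2 - e * s + 1).
  rewrite ler_expR; have : e * s <= 1 / 6 * s by rewrite ler_wpM2r.
  lra.
have H3 : expR s <= 4 * Cm ^+ 2 * expR (s - 2 * e * s + 2).
  apply: le_trans H _.
  have -> : expR (s - 2 * e * s + 2) =
      expR (s / 2 - e * s + 1) * expR (s / 2 - e * s + 1).
    by rewrite -expRD; congr expR; field.
  move: (expR (s / 2 - e * s + 1)) H1 H2 => X H1 H2.
  rewrite (_ : 4 * Cm ^+ 2 * (X * X) = (Cm * (X + X)) ^+ 2); last by ring.
  apply: ler_pM.
  - by rewrite mulr_ge0 ?addr_ge0 ?expR_ge0 //; lra.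
  - by rewrite mulr_ge0 ?addr_ge0 ?expR_ge0 //; lra.
  - by rewrite ler_wpM2l; lra.
  - by rewrite ler_wpM2l; lra.
have C0 : 0 < 4 * Cm ^+ 2 by rewrite mulr_gt0 // exprn_gt0 //; lra.
move: H3; rewrite -(lnK C0) -/c -expRD ler_expR.
move: cs; rewrite ltr_pdivrMr; last by lra.
nra.
Qed.

Lemma lg_le_sz : exists K : R, [/\ log_const K,
  forall p, good (1 / 4) p -> lg p <= sz p + K &
  forall p, good (1 / 4) p -> K <= sz p -> qdet p != 0].
Proof.
have [S HS] := qdet_neq0_large; have [M HM] := lg_bounded S.
have [K0 HK0 _] := log_const_ex 0.
have [K HK] := log_const_ex (Num.max K0 (Num.max S M)).
rewrite !ge_max => /andP[k0 /andP[kS kM]].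
exists K; split => // p gp; have [pp g] := gp; have s0 := sz_ge0 pp.
  case: (leP S (sz p)) => h.
    have l0 : 0 <= lg p by lra.
    by have := log_qdet HK0 pp l0 (HS _ gp h); lra.
  have := HM p pp; lra.
move=> h; apply: HS => //; lra.
Qed.

Definition gap_prop (e S : R) : Prop := forall (y h : pt), good (1 / 4) y ->
  S <= sz y -> 0 < hnorm h -> dot h y = 0 -> e / 2 * sz y <= ln (hnorm h).

(* Let s be the smallest good point of precision > sz y / 2 off the plane, and
   t a good point just below s: if t is in the plane, then dot h s is at most
   about hnorm h * exp (sz s - lg t - sz t), with negative exponent;
   otherwise s is small compared with y, which takes the role of t. *)
Lemma gap (K : R) : log_const K -> (forall p, good (1 / 4) p -> lg p <= sz p + K) ->
  exists S : R, gap_prop e S.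
Proof.
move=> HK lgs; have e0' := e_gt0; have e1 := e_le; have K1 := HK.1.
have [T0 HT] : exists T0 : R, forall T, T0 <= T ->
  exists p, [/\ good (1 / 4) p, sz p < T & (1 / 2 + e) * T - 1 <= lg p].
  by apply: unif; apply/andP; split; lra.
(* The second bound puts [sz s], which exceeds [sz y / 2 - K], beyond [T0]. *)
pose S := Num.max (10 * K / e) (2 * (T0 + K)).
exists S => y h gy; rewrite ge_max => /andP[Sy1 Sy2] h0 hy.
have [py ly] := gy.
have Ky : 10 * K <= e * sz y by move: Sy1; rewrite ler_pdivrMr // [sz y * _]mulrC.
have sy0 : 60 * K <= sz y.
  have := sz_ge0 py; nra.
set H := ln (hnorm h).
have [|s [ps [gs hs ls] smin]] :=
  @min_sz (fun p => [/\ good (1/4) p, dot h p != 0 & sz y / 2 < lg p]).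
  (* If all precise good points were in the plane, the linear form of [h] at [(1, xi, xi^2)] would
     be at most [hnorm h * Lp p] with [Lp p] arbitrarily small, hence 0. *)
  apply: contrapT => nex.
  have all0 p : good (1/4) p -> sz y / 2 < lg p -> dot h p = 0.
    move=> gp lp; apply/eqP/negPn/negP => hp; apply: nex; exists p.
    by split; first exact: gp.1.
  have := xi_indep (hnorm_nz h0); set th := (_ + _) => th0.
  have th1 : 0 < `|th| by rewrite normr_gt0.
  pose T := Num.max T0 (Num.max (sz y + 3) (2 * (H - ln `|th| + 2))).
  have [|p [gp sp lp]] := HT T; first by rewrite /T le_max lexx.
  have [pp _] := gp.
  have T1 : sz y + 3 <= T by rewrite /T !le_max lexx orbT.
  have T2 : 2 * (H - ln `|th| + 2) <= T by rewrite /T !le_max lexx !orbT.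
  have eT : 0 <= e * T by rewrite mulr_ge0 //; lra.
  have hp : dot h p = 0 by apply: all0 => //; lra.
  have := dotE h p; rewrite hp -/th => /esym/eqP; rewrite subr_eq add0r => /eqP E.
  have B := hdot_le h p; rewrite -E normrM in B.
  have P1' := e0_ge1 pp.
  have B2 : `|th| <= hnorm h * Lp p.
    apply: le_trans B; rewrite (ger0_norm (_ : 0 <= e0 p)); last by lra.
    by rewrite ler_peMl.
  move: B2; rewrite -(lnK th1) -(lnK h0) Lp_exp // -expRD ler_expR -/H; lra.
have sK : sz y / 2 - K < sz s by have := lgs _ gs; lra.
have [|t [gt st lt]] := HT (sz s); first by lra.
have [pt' _] := gt.
have tK := lgs _ gt.
have es : e * (sz y / 2 - K) <= e * sz s by rewrite ler_wpM2l; lra.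
have eK : e * K <= 1/6 * K by rewrite ler_wpM2r; lra.
have ey : e * sz y <= 1/6 * sz y by rewrite ler_wpM2r; lra.
case: (eqVneq (dot h t) 0) => ht.
  have := log_perp HK ps pt' hs ht; rewrite -/H; case; lra.
(* The minimality of [s] makes [t] imprecise, so [sz s] is at most about [sz y], small enough for
   [log_perp] with [y]. *)
have lt2 : lg t <= sz y / 2.
  rewrite leNgt; apply/negP => lt2; exact: (smin _ pt' st).
have es0 : 0 <= e * sz s by rewrite mulr_ge0 //; lra.
have := log_perp HK ps py hs hy; rewrite -/H; case; lra.
Qed.

End Uniform.

(** * The replacement step and its iteration *)

Lemma good_lg_gt (w eta t : R) : uniform w -> 1 / 2 <= w -> 0 < eta < 1 ->
  exists p, [/\ good eta p & t < lg p].
Proof.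
move=> U w2 e01; have [T0 HT] := U _ e01.
pose T := Num.max T0 (Num.max 0 (2 * (t + 2))).
have [|p [gp _ lp]] := HT T; first by rewrite /T le_max lexx.
exists p; split => //; apply: lt_le_trans lp.
have T1 : 0 <= T by rewrite /T !le_max lexx orbT.
have T2 : 2 * (t + 2) <= T by rewrite /T !le_max lexx !orbT.
have : 1 / 2 * T <= w * T by rewrite ler_wpM2r.
lra.
Qed.

(* Between the sizes of y and z, the point x forces the plane of y and z to
   have small height; hence it contains two consecutive good points a, b whose
   quotient moves y to a good point strictly between y and z. *)
Lemma step (e K S eps eta : R) : 0 < e -> e <= 1 / 6 -> uniform (1 / 2 + e) ->
  log_const K -> (forall p, good (1 / 4) p -> lg p <= sz p + K) ->
  (forall p, good (1 / 4) p -> K <= sz p -> qdet p != 0) ->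
  gap_prop e S -> eps <= e * e / 8 -> 0 < eta -> eta <= e * e / 200 ->
  exists S' : R, forall x y, good eps x -> S' <= sz x ->
    (forall p, good (6 * eta) p -> sz p <= sz x -> lg p < lg x) ->
    good eta y -> lg y <= lg x ->
    exists p, [/\ good (6 * eta) p, lg y + e / 16 * sz x <= lg p & lg p <= lg x].
Proof.
move=> e0' e6 U HK lgs qnz gapS epsE eta0 etaE.
have K1 := HK.1.
have eg := ltW e0'; have etag := ltW eta0.
have ee : e * e <= 1 / 36 by move: eg e6; clear; nra.
have eta01 : 0 < eta < 1 by apply/andP; split=> //; move: ee etaE; clear; lra.
have eta601 : 0 < 6 * eta < 1 by apply/andP; split; move: eta0 ee etaE; clear; lra.
have eta4 : eta <= 1 / 4 by move: ee etaE; clear; lra.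
have eta64 : 6 * eta <= 1 / 4 by move: ee etaE; clear; lra.
have eps4 : eps <= 1 / 4 by move: ee epsE; clear; lra.
have w2 : 1 / 2 <= 1 / 2 + e by rewrite lerDl.
have [T1 HT1] := U _ eta01.
pose S0 := Num.max 0 (Num.max S T1) + 5.
(* Makes [K + S0] negligible against [e * e * eta * sz x], hence against [eta * sz x] and [N]
   below. *)
pose S' := 100 * (K + S0) / (e * e * eta).
have S0_5 : 5 <= S0 by rewrite /S0 lerDr le_max lexx.
have S0_S : S <= S0.
  have : S <= Num.max 0 (Num.max S T1) by rewrite !le_max lexx !orbT.
  by rewrite /S0; clear; lra.
have S0_T : T1 <= S0.
  have : T1 <= Num.max 0 (Num.max S T1) by rewrite !le_max lexx !orbT.
  by rewrite /S0; clear; lra.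
exists S' => x y1 gx Sx nox gy1 ly1.
have pee : 0 < e * e by apply: mulr_gt0.
have peee : 0 < e * e * eta by apply: mulr_gt0.
have big0 : 100 * (K + S0) <= e * e * eta * sz x.
  by move: Sx; rewrite /S' ler_pdivrMr // [sz x * _]mulrC.
have [px gx2] := gx; have sx0 := sz_ge0 px.
have g4 eta' p : eta' <= 1 / 4 -> good eta' p -> good (1 / 4) p by exact: good_le.
have gx4 : good (1 / 4) x by apply: (g4 eps).
have lxK := lgs _ gx4.
clearbody S0 S'.
have esx0 : 0 <= eta * sz x by apply: mulr_ge0.
have bigeta : 100 * (K + S0) <= eta * sz x.
  apply: le_trans big0 _; rewrite -mulrA ler_piMl //.
  by move: ee; clear; lra.
have eta1 : eta * sz x <= 1 / 100 * sz x.
  by rewrite ler_wpM2r //; move: ee etaE; clear; lra.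
have [N NE] : exists N, N = e * e * sz x by exists (e * e * sz x).
have bigN : 200 * (eta * sz x) <= N.
  by rewrite NE mulrA ler_wpM2r //; move: etaE; clear; lra.
have esx_ge0 : 0 <= e * sz x by apply: mulr_ge0.
have Nesx : N <= e * sz x / 6.
  by rewrite NE -mulrA; move: esx_ge0 e6 eg; clear; nra.
have esx : e * sz x <= sz x / 6 by move: sx0 e6; clear; nra.
have epsx : eps * sz x <= N / 8.
  have : eps * sz x <= e * e / 8 * sz x by rewrite ler_wpM2r.
  by rewrite NE; clear; lra.
(* By minimality of [z], every [6 * eta]-good point smaller than [z] has precision at most [lg x].
   This applies to [y'] and finally to [p]. *)
have [z [pz [gz lz] zmin]] : exists z, [/\ pos z, good (6 * eta) z /\ lg x < lg z &
   forall p', pos p' -> sz p' < sz z -> ~ (good (6 * eta) p' /\ lg x < lg p')].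
  apply: min_sz; have [p [gp lp]] := good_lg_gt (lg x) U w2 eta601.
  by exists p; split; first exact: gp.1.
have sxz : sz x < sz z.
  by rewrite ltNge; apply/negP => /(nox _ gz); rewrite ltNge (ltW lz).
have gee p : good eta p -> good (6 * eta) p.
  by apply: good_le; move: etag; clear; lra.
have [y' [gy' sy'z ly']] :
    exists p, [/\ good eta p, sz p < sz z & (1 / 2 + e) * sz z - 1 <= lg p].
  by apply: HT1; move: sxz eta1 bigeta K1 S0_T S0_5; clear; lra.
have ly'x : lg y' <= lg x.
  rewrite leNgt; apply/negP => h; apply: (zmin y') => //; first exact: gy'.1.
  by split => //; exact: gee.
have [y [gy lyx lyz ly1y]] : exists y, [/\ good eta y, lg y <= lg x,
    (1 / 2 + e) * sz z - 1 <= lg y & lg y1 <= lg y].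
  case: (leP (lg y1) (lg y')) => h; first by exists y'.
  by exists y1; split => //; exact: le_trans ly' (ltW h).
suff [p [gp lp1 lp2]] :
    exists p, [/\ good (6 * eta) p, lg y + e / 16 * sz x <= lg p & lg p <= lg x].
  by exists p; split => //; apply: le_trans lp1; rewrite lerD2r.
clear y1 gy1 ly1 ly1y y' gy' sy'z ly' ly'x.
have [py gy2] := gy; have [_ gz2] := gz.
have sy0 := sz_ge0 py.
(* Otherwise [x] would inherit [eta]-goodness from [y] and contradict its own hypothesis at
   [p = x]. *)
have syx : sz y < sz x.
  rewrite ltNge; apply/negP => h.
  have gxx : good (6 * eta) x.
    apply: gee; split => //; apply: le_trans lyx; apply: le_trans gy2.
    by rewrite ler_wpM2l //; move: eta4; clear; lra.
  by have := nox _ gxx (lexx _); rewrite ltxx.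
have gy4 : good (1 / 4) y by exact: (g4 eta).
have gz4 : good (1 / 4) z by exact: (g4 (6 * eta)).
have lyK := lgs _ gy4; have lzK := lgs _ gz4.
have ez_ge : e * sz x <= e * sz z by rewrite ler_wpM2l // ltW.
have sy_low : sz x / 2 + e * sz x - 1 - K <= sz y.
  by move: lyK lyz ez_ge sxz; clear; lra.
have sz3 : sz z <= 3 * sz x.
  by move: lyK lyz ez_ge esx_ge0 syx bigeta eta1 K1 S0_5; clear; lra.
have etaz : eta * sz z <= 3 * (eta * sz x).
  by rewrite mulrCA ler_wpM2l.
have etay : eta * sz y <= eta * sz x by rewrite ler_wpM2l // ltW.
have Dxyz : dot (wedge y x) z = 0.
  apply/eqP/negPn/negP => Dn.
  have := log_det HK py px pz (ltW syx) (ltW sxz) lyx (ltW lz) Dn.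
  by move: lyz lyx ez_ge Nesx bigN bigeta K1 S0_5; clear; lra.
have Sy : S <= sz y.
  by move: S0_S sy_low esx_ge0 eta1 bigeta K1 S0_5; clear; lra.
have [d dE] : exists d, d = sz z - lg y by exists (sz z - lg y).
have d_low : e / 2 * sz y <= K + d.
  have w0 := wedge_gt0 py pz (lt_trans syx sxz) (le_trans lyx (ltW lz)).
  have := gapS y _ gy4 Sy w0 (dot_wedgel _ _).
  have := log_cross HK py pz (ltW (lt_trans syx sxz)) (le_trans lyx (ltW lz)) w0.
  by rewrite dE; clear; lra.
have eK : e * K <= 1 / 6 * K by rewrite ler_wpM2r //; move: K1; clear; lra.
have eeK : e * e * K <= 1 / 36 * K by rewrite ler_wpM2r //; move: K1; clear; lra.
have ey : e * (sz x / 2 - 2 * K) <= e * sz y.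
  by rewrite ler_wpM2l //; move: sy_low esx_ge0 K1; clear; lra.
have ed_low : N / 4 - K <= e * d.
  have h1 : e * (e / 2 * sz y) <= e * (K + d) by rewrite ler_wpM2l.
  have h2 : e * e * (sz x / 2 - 2 * K) <= e * e * sz y.
    by rewrite (ler_wpM2l (ltW pee)) //; move: sy_low esx_ge0 K1; clear; lra.
  by move: h1 h2 eK eeK K1; rewrite NE; clear; lra.
(* Both wedges are normal to the common plane; the bounds for their logarithmic norms add up to
   [d + (sz x - lg x) + 2 * K], so the smaller norm obeys half of this. *)
have [h [h0 hx hy hz hH]] : exists h, [/\ 0 < hnorm h, dot h x = 0, dot h y = 0, dot h z = 0 &
    ln (hnorm h) <= d / 2 + eps * sz x / 2 + K].
  have w1 := wedge_gt0 py px syx lyx; have w2' := wedge_gt0 px pz sxz (ltW lz).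
  have c1 := log_cross HK py px (ltW syx) lyx w1.
  have c2 := log_cross HK px pz (ltW sxz) (ltW lz) w2'.
  case: (leP (ln (hnorm (wedge y x))) (ln (hnorm (wedge x z)))) => hc.
    exists (wedge y x); split => //; rewrite ?dot_wedgel ?dot_wedger //.
    by move: c1 c2 hc gx2; rewrite dE; clear; lra.
  exists (wedge x z); split => //; rewrite ?dot_wedgel ?dot_wedger //.
    by rewrite dot_wedgeC.
  by move: c1 c2 hc gx2; rewrite dE; clear; lra.
have d_up : d <= sz z / 2 - e * sz z + 1 by move: lyz; rewrite dE; clear; lra.
have d0 : 0 <= d.
  rewrite leNgt; apply/negP => hd.
  have : e * d <= 0 by rewrite pmulr_rle0 // ltW.
  by move: ed_low bigN bigeta K1 S0_5; clear; lra.
have ed6 : e * d <= 1 / 6 * d by rewrite ler_wpM2r.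
have d_big : 100 * (K + S0) <= d.
  by move: ed6 ed_low bigN bigeta K1 S0_5; clear; lra.
(* [b] is the smallest [eta]-good point of precision above [d], so the good point [a] just below it
   has [lg a <= d < lg b]. *)
have [b [pb [gb lb] bmin]] : exists b, [/\ pos b, good eta b /\ d < lg b &
   forall p', pos p' -> sz p' < sz b -> ~ (good eta p' /\ d < lg p')].
  apply: min_sz; have [p [gp lp]] := good_lg_gt d U w2 eta01.
  by exists p; split; first exact: gp.1.
have gb4 : good (1 / 4) b by exact: (g4 eta).
have lbK := lgs _ gb4.
have [a [ga sab la_low]] :
    exists p, [/\ good eta p, sz p < sz b & (1 / 2 + e) * sz b - 1 <= lg p].
  by apply: HT1; move: lbK lb d_big S0_T K1 S0_5; clear; lra.
have [pa ga2] := ga; have [_ gb2] := gb.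
have la : lg a <= d.
  by rewrite leNgt; apply/negP => hla; apply: (bmin a).
have ga4 : good (1 / 4) a by exact: (g4 eta).
have laK := lgs _ ga4.
have sa0 := sz_ge0 pa.
have eb_low : e * d - K <= e * sz b.
  have : e * (d - K) <= e * sz b.
    by rewrite ler_wpM2l //; move: lb lbK; clear; lra.
  by move: eK K1; clear; lra.
have sb_up : sz b <= 2 * d + 2.
  by move: la la_low eb_low ed_low bigN bigeta K1 S0_5; clear; lra.
have sb4 : sz b <= 4 * sz x.
  by move: sb_up d_up sz3 ez_ge esx_ge0 bigeta eta1 K1 S0_5; clear; lra.
have etab : eta * sz b <= 4 * (eta * sz x) by rewrite mulrCA ler_wpM2l.
have etaa : eta * sz a <= eta * sz b by rewrite ler_wpM2l // ltW.
(* Outside the plane both alternatives of [log_perp] fail: [a] is too small for the first and too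
   precise for the second; likewise [b]. *)
have ha : dot h a = 0.
  apply/eqP/negPn/negP => hn.
  case: (log_perp HK pa pz hn hz) => hc.
    move: hc hH epsx gz2 sab sb_up d_up ez_ge Nesx bigN bigeta etaz sxz eta1 K1 S0_5.
    by clear; lra.
  move: hc hH epsx la_low eb_low ed_low lb lbK bigN bigeta K1 S0_5.
  by clear; lra.
have hb : dot h b = 0.
  apply/eqP/negPn/negP => hn.
  case: (log_perp HK pb pz hn hz) => hc.
    move: hc hH epsx gz2 sb_up d_up ez_ge Nesx bigN bigeta etaz sxz eta1 K1 S0_5.
    by clear; lra.
  by move: hc hH epsx lb ed6 ed_low bigN bigeta K1 S0_5; clear; lra.
have hnz := hnorm_nz h0.
(* The plane of [a] and [b] contains [y], so the gap bounds [sz b - lg a] below: this is the gain in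
   the second alternative of [log_bracket], and [zy_low] that in the first. *)
have ab_low : e / 2 * sz y <= K + sz b - lg a.
  have lab : lg a <= lg b by exact: le_trans la (ltW lb).
  have w0 := wedge_gt0 pa pb sab lab.
  apply: le_trans (gapS y _ gy4 Sy w0 (dot_wedge_eq0 hnz ha hb hy)) _.
  exact: log_cross HK pa pb (ltW sab) lab w0.
have zy_low : e / 8 * sz x <= sz z - sz y.
  by move: d_low gy2 ey etay Nesx bigN bigeta eK K1 S0_5; rewrite dE; clear; lra.
have say : sz a <= sz y.
  move: la ga2 etaa etab d_up sy_low ez_ge lyz lyK Nesx bigN bigeta K1 S0_5.
  by clear; lra.
have sa_big : K <= sz a.
  by move: laK la_low eb_low ed_low bigN lb lbK d_big bigeta K1 S0_5; clear; lra.
have la4 : 4 <= lg a.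
  by move: la_low eb_low ed_low bigN lb lbK d_big bigeta K1 S0_5; clear; lra.
have ly4 : 4 <= lg y.
  by move: lyz sxz ez_ge esx_ge0 bigeta eta1 K1 S0_5; clear; lra.
have lb4 : 4 <= lg b by move: lb d_big K1 S0_5; clear; lra.
have qa : qdet a != 0 by exact: qnz.
have qy : qdet y != 0 by apply: qnz => //; exact: le_trans say.
have Hyz : 2 * sz y - lg z + K <= sz z.
  by move: zy_low gz2 etaz Nesx bigN bigeta K1 S0_5; clear; lra.
have Dp : dot (wedge (bracket y a b) y) z = 0.
  by apply: (dot_wedge_eq0 hnz) => //; exact: dot_bracket.
have [p [pp sp lp]] :=
  log_bracket HK py pa pb pz ly4 la4 lb4 qa qy say (ltW sab) Hyz Dp.
(* Up to constants, [sz b - lg a] is smaller than [d] by a multiple of [e * d], and [sz y + d]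
   exceeds [sz z] by at most [eta * sz y]. *)
have sp_up : sz p <= sz z - N / 4.
  move: sp gy2 etay dE la la_low eb_low ed_low bigN bigeta K1 S0_5.
  by clear; lra.
have sp0 := sz_ge0 pp.
have lp_low : lg y + e / 16 * sz x <= lg p.
  case: lp => lp.
    move: lp sp_up zy_low gz2 etaz Nesx bigN bigeta esx_ge0 K1 S0_5.
    by clear; lra.
  move: lp gy2 etay ga2 etaa gb2 etab ab_low ey eK Nesx bigN bigeta esx_ge0 K1 S0_5.
  by clear; lra.
have gp : good (6 * eta) p.
  have N0 : 0 <= N by move: bigN bigeta K1 S0_5; clear; lra.
  have zp : N / 4 <= sz z - sz p by move: sp_up; clear; lra.
  split=> //; case: lp => lp.
    have e4 : eta * (sz z - sz p) <= 1 / 24 * (sz z - sz p).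
      rewrite ler_wpM2r //; first by apply: le_trans zp; apply: divr_ge0.
      by move: eta64; clear; lra.
    move: lp e4 zp gy2 etay gz2 bigN bigeta K1 S0_5; clear; lra.
  (* As [sz a <= sz y] and [sz a < sz b], the factor 6 covers the losses from [y], [a] and [b] and
     leaves a multiple of [eta * sz y] for the constants. *)
  have t1 : (1 - 6 * eta) * sz p <= (1 - 6 * eta) * (sz y + sz b - lg a + K).
    by rewrite ler_wpM2l //; move: eta64; clear; lra.
  have etaK : eta * K <= K.
    by rewrite ler_piMl //; move: eta4 K1; clear; lra.
  have t2 : eta * lg a <= eta * sz a + eta * K.
    by rewrite -mulrDr ler_wpM2l.
  have t3 : eta * (sz x / 2 - 2 * K) <= eta * sz y.
    by rewrite ler_wpM2l //; move: sy_low esx_ge0 K1; clear; lra.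
  have t6 : eta * sz a <= eta * sz y by rewrite ler_wpM2l.
  move: t1 t2 t3 t6 etaK lp gy2 ga2 gb2 etaa bigeta K1 S0_5; clear; lra.
exists p; split => //.
rewrite leNgt; apply/negP => hp; apply: (zmin p) => //.
by apply: le_lt_trans sp_up _; move: bigN bigeta K1 S0_5; clear; lra.
Qed.

(** If no such [p] exists, [step] applies repeatedly to the same [x]; [M] gains of [e / 16 * sz x]
    give [2 * sz x <= lg x], against [lg x <= sz x + K]. *)
Lemma better_approximation (e eps eps' : R) :
  (forall h : pt, pt_nz h ->
    (pt0 h)%:~R + (pt1 h)%:~R * xi + (pt2 h)%:~R * xi ^+ 2 != 0) ->
  0 < e -> e <= 1 / 6 -> uniform (1 / 2 + e) -> eps <= e * e / 8 -> 0 < eps' ->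
  exists S : R, forall x, good eps x -> S <= sz x ->
    exists p, [/\ good eps' p, sz p <= sz x & lg x <= lg p].
Proof.
move=> xi_indep e0' e6 U epsE eps'0.
have [K [HK lgs qnz]] := lg_le_sz e0' e6 U.
have [S gapS] := gap xi_indep e0' e6 U HK lgs.
pose M := (Num.truncn (32 / e)).+1.
have HM : 2 <= M%:R * (e / 16).
  have := Num.Theory.truncnS_gt (32 / e); rewrite -/M ltr_pdivrMr // => h.
  by move: h; clear; lra.
pose m := Num.min eps' (e * e / 200).
have pee : 0 < e * e by apply: mulr_gt0.
have m0 : 0 < m by rewrite /m lt_min eps'0 /= divr_gt0.
have m_eps' : m <= eps' by rewrite /m ge_min lexx.
have m_e : m <= e * e / 200 by rewrite /m ge_min lexx orbT.
(* Goodness degrades by a factor 6 per step and ends at [eta M = m], which respects [eps'] and the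
   bound required by [step]. *)
pose eta j := m * 6 ^+ j / 6 ^+ M.
have eta_gt0 j : 0 < eta j by rewrite /eta divr_gt0 ?mulr_gt0 ?exprn_gt0.
have eta_le j : (j <= M)%N -> eta j <= m.
  move=> jM; rewrite /eta ler_pdivrMr ?exprn_gt0 // ler_pM2l //.
  by rewrite ler_weXn2l // ler1n.
have etaS j : 6 * eta j = eta j.+1 by rewrite /eta exprS; ring.
have eps2 : eps <= 1 / 2.
  apply: le_trans epsE _; have : e * e <= 1 / 36 by move: e0' e6; clear; nra.
  by clear; lra.
have iter j : (j <= M)%N -> exists S1 : R, forall x, good eps x -> S1 <= sz x ->
    (forall p, good eps' p -> sz p <= sz x -> lg p < lg x) ->
    exists y, [/\ good (eta j) y, j%:R * (e / 16) * sz x <= lg y & lg y <= lg x].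
  elim: j => [|j IH] jM.
    have eta1 : 0 < eta 0%N < 1.
      rewrite eta_gt0 /=; apply: le_lt_trans (eta_le _ jM) _; apply: le_lt_trans m_e _.
      by move: e0' e6; clear; nra.
    have w2 : 1 / 2 <= 1 / 2 + e by move: e0'; clear; lra.
    have [y [gy ly]] := good_lg_gt 0 U w2 eta1.
    exists (2 * lg y) => x [px gx] Sx _; exists y; split => //.
      by rewrite !mul0r ltW.
    apply: le_trans gx; apply: (@le_trans _ _ (1 / 2 * sz x)).
      by move: Sx; clear; lra.
    by rewrite ler_wpM2r ?sz_ge0 //; move: eps2; clear; lra.
  have [S1 H1] := IH (ltnW jM).
  have etaj : eta j <= e * e / 200 := le_trans (eta_le _ (ltnW jM)) m_e.
  have [S2 H2] := step e0' e6 U HK lgs qnz gapS epsE (eta_gt0 j) etaj.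
  exists (Num.max S1 S2) => x gx; rewrite ge_max => /andP[s1 s2] nox.
  have [y [gy ly1 ly2]] := H1 x gx s1 nox.
  have [|p [gp lp1 lp2]] := H2 x y gx s2 _ gy ly2.
    move=> p gp; apply: nox; apply: good_le gp; rewrite etaS.
    exact: le_trans (eta_le _ jM) m_eps'.
  exists p; split => //; first by rewrite -etaS.
  apply: le_trans lp1; rewrite -natr1; move: ly1; clear; lra.
have [S1 H1] := iter M (leqnn M).
exists (Num.max S1 (K + 1)) => x gx; rewrite ge_max => /andP[s1 s2].
apply: contrapT => nex.
have [|y [gy ly1 ly2]] := H1 x gx s1.
  move=> p gp sp; rewrite ltNge; apply/negP => lp; apply: nex; exists p; split => //.
have gx4 : good (1 / 4) x.
  apply: good_le gx; apply: le_trans epsE _.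
  by move: e0' e6; clear; nra.
have := lgs _ gx4; have K1 := HK.1.
have : 2 * sz x <= M%:R * (e / 16) * sz x by rewrite ler_wpM2r // (sz_ge0 gx.1).
by move: ly1 ly2 s2 K1; clear; lra.
Qed.

(** * Logarithmic form of [beta_set] *)

(** The substitution is [B = expR T]; a change of sign of the triple makes [x0] positive. *)
Lemma beta_setP (eps b : R) : beta_set eps xi b <-> 0 < b /\
  exists T0 : R, forall T, T0 <= T ->
  exists p, [/\ good eps p, sz p <= T & T / b <= lg p].
Proof.
have tr (p : pt) (B : R) : pos p -> 0 < B -> 0 < b ->
    (Lp p <= Num.min (B `^ (- (1 / b))) (e0 p `^ (eps - 1))) =
    (ln B / b <= lg p) && ((1 - eps) * sz p <= lg p).
  move=> pp B0 b0; rewrite le_min.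
  have q0 : 0 < e0 p by have := e0_ge1 pp; clear; lra.
  rewrite /powR !gt_eqF // !Lp_exp // !ler_expR.
  congr (_ && _); apply/idP/idP; rewrite /sz; clear; lra.
split=> [[b0 [M [_ H]]]|[b0 [T0 H]]]; split => //.
  exists M => T MT.
  have [|x0 [x1 [x2 [x0ge x0B HL]]]] := H (expR T).
    by have := expR_ge1Dx T; move: MT; clear; lra.
  have [p [pp p0 pL]] : exists p, [/\ pos p, pt0 p = `|x0| & Lp p = Lxi xi x0 x1 x2].
    case: (leP 0 x0) => s0.
      exists (Pt x0 x1 x2); split => //; rewrite /pos /= ?ger0_norm //.
      by move: x0ge; rewrite ger0_norm.
    exists (Pt (- x0) (- x1) (- x2)); split => //=.
    - by move: x0ge; rewrite /pos /= ltr0_norm.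
    - by rewrite ltr0_norm.
    rewrite /Lp /Lxi; congr Num.max; rewrite -normrN; congr `|_|.
      rewrite /d1 /=; ring.
    rewrite /d2 /=; ring.
  move: x0B HL; rewrite -pL -p0 -/(e0 p) tr ?expR_gt0 // expRK => x0B /andP[h1 h2].
  exists p; split => //.
  by rewrite -ler_expR -e0_exp.
exists (expR T0); split; first exact: num_real.
move=> B HB; have B0 : 0 < B := lt_trans (expR_gt0 _) HB.
have [|p [[pp gp] sp lp]] := H (ln B).
  by rewrite -(expRK T0) ler_ln ?posrE ?expR_gt0 // ltW.
exists (pt0 p), (pt1 p), (pt2 p).
have pE : `|pt0 p| = pt0 p by rewrite ger0_norm //; move: pp; rewrite /pos; clear; lia.
rewrite !pE; split => //.
  by rewrite -/(e0 p) e0_exp // -(lnK B0) ler_expR.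
by rewrite -/(e0 p) -[Lxi _ _ _ _]/(Lp p) tr // lp.
Qed.

End Approximation.

(** * Rational independence of [1], [xi], [xi^2] *)

Lemma irrational_int (R : realType) (xi : R) : irrational xi ->
  forall n m : int, n != 0 -> n%:~R * xi != m%:~R.
Proof.
move=> irr n m n0; apply/negP => /eqP E; apply: irr.
exists (m%:~R / n%:~R) => //; rewrite fmorph_div !rmorph_int -E mulrC mulKf //.
by rewrite intr_eq0.
Qed.

Lemma irrational_rat (R : realType) (xi : R) : irrational xi ->
  forall u v : rat, ratr u + ratr v * xi = 0 -> u = 0 /\ v = 0.
Proof.
move=> irr u v H; case: (eqVneq v 0) => v0.
  move: H; rewrite v0 rmorph0 mul0r addr0 => /eqP; rewrite fmorph_eq0 => /eqP ->.
  by [].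
exfalso; apply: irr; exists (- u / v) => //; rewrite fmorph_div rmorphN.
have v0' : ratr v != 0 :> R by rewrite fmorph_eq0.
apply: (mulfI v0'); rewrite mulrCA divff // mulr1.
by move: H => /eqP; rewrite addrC addr_eq0 => /eqP ->.
Qed.

Lemma quadratic_divring_closed (R : realType) (xi : R) (s t : rat) : irrational xi ->
  xi ^+ 2 = ratr s + ratr t * xi ->
  GRing.divring_closed
    [pred y : R | `[< exists u v : rat, y = ratr u + ratr v * xi >]].
Proof.
move=> irr sq; split.
- by apply/asboolP; exists 1, 0; rewrite rmorph1 rmorph0 mul0r addr0.
- move=> x y /asboolP [u [v ->]] /asboolP [u' [v' ->]]; apply/asboolP.
  by exists (u - u'), (v - v'); rewrite !rmorphB /=; ring.
move=> x y /asboolP [u [v ->]] /asboolP [u' [v' ->]]; apply/asboolP.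
case: (eqVneq (ratr u' + ratr v' * xi) 0) => y0.
  by exists 0, 0; rewrite y0 invr0 mulr0 rmorph0 mul0r addr0.
(* [n] is the norm of [u' + v' xi], whose conjugate is [u' + v' t - v' xi]. *)
pose n : rat := u' * u' + u' * v' * t - v' * v' * s.
have nE : (ratr u' + ratr v' * xi) * (ratr (u' + v' * t) + ratr (- v') * xi) = ratr n.
  rewrite /n !(rmorphD, rmorphB, rmorphM, rmorphN) /=.
  transitivity (ratr u' * ratr u' + ratr u' * ratr v' * ratr t
    + ratr v' * ratr v' * ratr t * xi - ratr v' * ratr v' * xi ^+ 2); first by ring.
  rewrite sq; ring.
have n0 : (ratr n : R) != 0.
  rewrite -nE mulf_neq0 //; apply/negP => /eqP /(irrational_rat irr) [E1 /eqP].
  rewrite oppr_eq0 => /eqP v0; move: y0 E1; rewrite v0 mul0r addr0 => y0 u0.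
  by move: y0; rewrite u0 !rmorph0 mul0r addr0 eqxx.
exists ((u * (u' + v' * t) - v * v' * s) / n), ((v * u' - u * v') / n).
rewrite !fmorph_div; apply: (mulIf y0); rewrite mulfVK //.
apply: (mulIf n0).
transitivity ((ratr (u * (u' + v' * t) - v * v' * s) + ratr (v * u' - u * v') * xi)
   * (ratr u' + ratr v' * xi) : R); last first.
  by field.
rewrite /n !(rmorphD, rmorphB, rmorphM, rmorphN) /=.
apply/eqP; rewrite -subr_eq0; apply/eqP.
set U : R := ratr u; set V : R := ratr v; set U' : R := ratr u'; set V' : R := ratr v'.
set S : R := ratr s; set T : R := ratr t.
transitivity ((xi ^+ 2 - S - T * xi) * (- (V * U' - U * V') * V')); last first.
  by rewrite sq /S /T; ring.
ring.
Qed.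

(** A relation with [pt2 h != 0] would confine [Q_adjoin xi] to [Q + Q xi], where three elements are
    dependent by the kernel of a 3 by 2 matrix. With [pt2 h = 0] irrationality suffices. *)
Lemma non_quadratic_indep (R : realType) (xi : R) : irrational xi -> non_quadratic xi ->
  forall h : pt, pt_nz h ->
  (pt0 h)%:~R + (pt1 h)%:~R * xi + (pt2 h)%:~R * xi ^+ 2 != 0.
Proof.
move=> irr [v [Hv Hfree]] [h0 h1 h2] /= nz; apply/negP => /eqP E.
case: (eqVneq h2 0) => h20.
  case: (eqVneq h1 0) => h10.
    apply: nz => /=; split => //; apply/eqP; rewrite -(intr_eq0 R).
    by move: E; rewrite h20 h10 !mul0r !addr0 => ->.
  have := irrational_int irr (- h0) h10; move: E; rewrite h20 mul0r addr0 => E.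
  by rewrite rmorphN /= => /eqP; apply; apply/eqP; rewrite -addr_eq0 addrC E.
have h2R : (h2%:~R : R) != 0 by rewrite intr_eq0.
have sq : xi ^+ 2 = ratr (- h0%:~R / h2%:~R) + ratr (- h1%:~R / h2%:~R) * xi.
  rewrite !fmorph_div !rmorphN !rmorph_int; apply: (mulfI h2R).
  transitivity (- h0%:~R - h1%:~R * xi : R); last by field.
  by apply/eqP; rewrite -subr_eq0; apply/eqP; rewrite -E; ring.
have Kc := quadratic_divring_closed irr sq.
have /choice [f Hf] : forall i, exists uv : rat * rat, v i = ratr uv.1 + ratr uv.2 * xi.
  move=> i.
  have xiK : xi \in [pred y : R | `[< exists u v : rat, y = ratr u + ratr v * xi >]].
    by apply/asboolP; exists 0, 1; rewrite rmorph0 rmorph1 add0r mul1r.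
  by have /asboolP [u [w ->]] := Hv i _ Kc xiK; exists (u, w).
pose A : 'M[rat]_(3, 2) := \matrix_(i, j) if j == 0 then (f i).1 else (f i).2.
have : kermx A != 0.
  rewrite -mxrank_eq0 mxrank_ker -lt0n subn_gt0.
  by apply: leq_ltn_trans (rank_leq_col A) _.
case/rowV0Pn=> c /sub_kermxP cA c0.
case/negP: c0; apply/eqP/rowP => i; rewrite mxE.
apply: (Hfree (fun i => c 0 i)).
have c1 : \sum_(i < 3) c 0 i * (f i).1 = 0.
  have := congr1 (fun M : 'rV_2 => M 0 0) cA; rewrite !mxE => cA'; rewrite -[RHS]cA'.
  by apply: eq_bigr => k _; rewrite mxE.
have c2 : \sum_(i < 3) c 0 i * (f i).2 = 0.
  have := congr1 (fun M : 'rV_2 => M 0 1) cA; rewrite !mxE => cA'; rewrite -[RHS]cA'.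
  by apply: eq_bigr => k _; rewrite mxE.
transitivity (ratr (\sum_(i < 3) c 0 i * (f i).1) +
    ratr (\sum_(i < 3) c 0 i * (f i).2) * xi : R).
  rewrite !rmorph_sum mulr_suml -big_split /=; apply: eq_bigr => k _.
  by rewrite Hf !rmorphM /=; ring.
by rewrite c1 c2 !rmorph0 mul0r addr0.
Qed.

(** * Comparison of the exponents and conclusion *)

Lemma beta_eps_ge0 (R : realType) (eps xi : R) : (0 <= beta_eps eps xi)%E.
Proof. by apply: le_ereal_inf_tmp => _ [b [b0 _] <-]; rewrite lee_fin ltW. Qed.

Lemma beta_eps_le_beta0 (R : realType) (eps xi : R) : 0 < eps < 1 ->
  (beta_eps eps xi <= beta0 xi)%E.
Proof. by move=> e01; apply: ereal_sup_ubound; exists eps. Qed.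

(** Since [beta_eps eta xi <= beta0 xi < b0], some [b < b0] lies in [beta_set eta xi], and then
    [b0^-1 <= b^-1]. *)
Lemma uniform_beta0 (R : realType) (xi b0 : R) :
  (forall n m : int, n != 0 -> n%:~R * xi != m%:~R) ->
  1 < b0 -> (beta0 xi < b0%:E)%E -> uniform xi b0^-1.
Proof.
move=> xi_irr b01 Hb eta e01.
have [_ [b bS <-]] := ereal_inf_lt (le_lt_trans (beta_eps_le_beta0 _ e01) Hb).
rewrite lte_fin => bb0.
have [b_gt0 [T0 HT]] := (beta_setP xi_irr eta b).1 bS.
exists (Num.max (T0 + 1) 1) => T; rewrite ge_max => /andP[T1 T2].
(* Passing to [T - 1] makes [sz p < T] strict and costs [b0^-1 <= 1], the slack in [uniform]. *)
have [|p [gp sp lp]] := HT (T - 1); first by move: T1; clear; lra.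
exists p; split => //; first by move: sp; clear; lra.
apply: le_trans lp.
have b0_gt0 : 0 < b0 by apply: lt_trans b01.
have iv : b0^-1 <= b^-1 by rewrite lef_pV2 ?posrE // ltW.
have iv1 : b0^-1 <= 1 by rewrite invf_le1 // ltW.
have : (T - 1) * b0^-1 <= (T - 1) * b^-1 by rewrite ler_wpM2l // subr_ge0.
by move: iv1; clear; lra.
Qed.

Lemma beta_set_sub (R : realType) (xi e eps eps' : R) :
  irrational xi -> non_quadratic xi ->
  0 < e -> e <= 1 / 6 -> uniform xi (1 / 2 + e) -> eps <= e * e / 8 -> 0 < eps' ->
  (beta_set eps xi `<=` beta_set eps' xi)%classic.
Proof.
move=> irr nq e0' e6 U epsE eps'0 b.
have xi_irr := irrational_int irr.
have [S HS] := better_approximation xi_irr (non_quadratic_indep irr nq) e0' e6 U epsE eps'0.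
have [M HM] := lg_bounded xi_irr S.
move=> /(beta_setP xi_irr) [b0 [T0 HT]]; apply/(beta_setP xi_irr); split => //.
(* [b * (M + 1) <= T] forces [lg x > M], hence [S <= sz x]. *)
exists (Num.max T0 (b * (M + 1))) => T; rewrite ge_max => /andP[T1 T2].
have [x [gx sx lx]] := HT T T1.
have [|p [gp sp lp]] := HS x gx.
  rewrite leNgt; apply/negP => /ltW /(HM _ gx.1) h.
  move: T2; rewrite mulrC -ler_pdivlMr // => T2.
  by move: h T2 lx; clear; lra.
by exists p; split => //; [exact: le_trans sx | exact: le_trans lp].
Qed.

Theorem theorem1p3 (R : realType) :
  exists eps1 : \bar R -> R,
    forall xi : R,
      irrational xi -> non_quadratic xi -> (beta0 xi < 2%:E)%E ->
      0 < eps1 (beta0 xi) /\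
      forall eps : R, 0 < eps < eps1 (beta0 xi) -> beta_eps eps xi = beta0 xi.
Proof.
(* The midpoint of [beta0 xi] and 2 lies strictly between them; the floor [3 / 2] keeps
   [e <= 2 / 3 - 1 / 2 = 1 / 6]. *)
pose b0 (v : \bar R) : R := Num.max ((fine v + 2) / 2) (3 / 2).
pose e v : R := (b0 v)^-1 - 1 / 2.
exists (fun v => e v * e v / 8) => xi irr nq b2.
have bpos : (0 <= beta0 xi)%E.
  apply: le_trans (beta_eps_ge0 (1 / 2) xi) (beta_eps_le_beta0 _ _).
  by apply/andP; split; lra.
have fb : beta0 xi \is a fin_num by rewrite ge0_fin_numE // (lt_trans b2) // ltry.
have fb2 : fine (beta0 xi) < 2 by rewrite -lte_fin fineK.
have b0_ge : 3 / 2 <= b0 (beta0 xi) by rewrite /b0 le_max lexx orbT.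
have b0_lt : b0 (beta0 xi) < 2.
  by rewrite /b0 gt_max; apply/andP; split; move: fb2; clear; lra.
have b0_gt : (beta0 xi < (b0 (beta0 xi))%:E)%E.
  rewrite -[ltLHS]fineK // lte_fin /b0 lt_max; apply/orP; left.
  by move: fb2; clear; lra.
have b0_gt0 : 0 < b0 (beta0 xi) by apply: lt_le_trans b0_ge.
have e_gt0 : 0 < e (beta0 xi).
  by rewrite /e subr_gt0 mul1r ltf_pV2 ?posrE.
have e_le : e (beta0 xi) <= 1 / 6.
  have : (b0 (beta0 xi))^-1 <= (3 / 2)^-1 by rewrite lef_pV2 ?posrE.
  by rewrite /e; clear; lra.
split; first by rewrite divr_gt0 // mulr_gt0.
move=> eps /andP[eps0 eps1].
have U : uniform xi (1 / 2 + e (beta0 xi)).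
  rewrite /e addrC subrK; apply: uniform_beta0 => //; first exact: irrational_int.
  by apply: lt_le_trans b0_ge; lra.
apply/eqP; rewrite eq_le; apply/andP; split.
  apply: beta_eps_le_beta0; rewrite eps0 /=; apply: lt_trans eps1 _.
  by move: e_gt0 e_le; clear; nra.
(* Each [eps'] in the supremum is compared with [eps]: inclusion of the sets reverses the infima. *)
apply: ge_ereal_sup => _ [eps' /= /andP[eps'0 _] <-].
apply: ereal_inf_le_tmp; apply: image_subset.
exact: (beta_set_sub irr nq e_gt0 e_le U (ltW eps1)).
Qed.
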